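(* Assume that $(\varphi,c)$ satisfies the critical density condition, and let $S=S(\varphi)$, $R=R(\varphi,c)$. (1) For any point $d\in\mathbb{P}^t\setminus\{c_i\}_{i\ge 0}$, the $S$-point module $P(d)$ is (by restriction) an $R$-point module, with point ideal $R\cap\mathfrak{m}_d$. (2) For each $i\ge 0$, the module $P(c_i)_{\ge i+1}$ is a shifted $R$-point module. There is a $\mathbb{P}^{t-1}$-parameterized family of pairwise non-isomorphic $R$-point modules $\{P(c_i,e)\mid e\in\mathbb{P}^{t-1}\}$ with $P(c_i,e)_{\ge i+1}\cong {}_R P(c_i)_{\ge i+1}$ and $P(c_i,e)_{\le i}\cong {}_R P(c_i)_{\le i}$ for every $e\in\mathbb{P}^{t-1}$. These are exactly the $R$-point modules whose point ideals contain the left ideal $R\cap\mathfrak{m}_{c_i}^2$ of $R$. (3) All of the point modules given in (1) and (2) are pairwise non-isomorphic, and every point module over $R$ is isomorphic to one of these.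
   Context: Let $k$ be an algebraically closed field, $t\ge 2$ an integer, $U=k[x_0,\dots,x_t]$ the commutative polynomial ring with $\deg x_i=1$, and $\mathbb{P}^t=\operatorname{Proj}U$; ''point'' means closed point. Multiplication in $U$ is written $\circ$. For a point $d$ let $\mathfrak{m}_d\subseteq U$ be its homogeneous ideal, and let $\mathfrak{m}_d^2$ be its square in the commutative ring $U$. Given $\varphi\in\operatorname{Aut}(\mathbb{P}^t)$, let $\phi$ be a graded $k$-algebra automorphism of $U$ with $\mathfrak{m}_{\varphi(d)}=\phi^{-1}(\mathfrak{m}_d)$ for all points $d$ ($\phi$ is unique up to a nonzero scalar multiple, which does not affect the isomorphism class of the algebras below). The (left) Zhang twist $S=S(\varphi)$ is the graded $k$-algebra with the same underlying graded vector space as $U$ and multiplication $fg=\phi^n(f)\circ g$ for $f\in U_m$, $g\in U_n$. For a point $c$, $R(\varphi,c)$ is the $k$-subalgebra of $S(\varphi)$ generated by the codimension-one subspace $(\mathfrak{m}_c)_1=\{f\in U_1 : f(c)=0\}$ of $S_1=U_1$. Put $c_i=\varphi^{-i}(c)$ for $i\in\mathbb{Z}$. An infinite set $\mathcal{C}$ of closed points of a variety $X$ is critically dense in $X$ if every proper Zariski-closed subset of $X$ contains only finitely many points of $\mathcal{C}$. The critical density condition on $(\varphi,c)$: $c$ has infinite order under $\varphi$ (the $c_i$ are distinct) and $\{c_i\}_{i\in\mathbb{Z}}$ is critically dense in $\mathbb{P}^t$. Modules are graded left modules, and isomorphisms are degree-preserving. A point module over a connected graded algebra $A$ generated in degree 1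 is a graded left module $M$ that is cyclic, generated in degree $0$, with $\dim_k M_n=1$ for all $n\ge0$; its point ideal is the left ideal $I$ of $A$ with $M\cong A/I$ (the annihilator of $M_0$). A shifted point module is a module $M[n]$ with $M$ a point module, where $M[n]_m=M_{n+m}$. Any homogeneous ideal of $U$, viewed as a subspace of $S$, is a graded left ideal of $S$; for a point $d$, $P(d)=S/\mathfrak{m}_d$ is the corresponding left $S$-point module. For a graded module $M$, $M_{\ge n}=\bigoplus_{j\ge n}M_j$ and $M_{\le n}$ denotes the truncation $M/M_{\ge n+1}$. ${}_RM$ denotes $M$ regarded as an $R$-module. *)

(* Defs.v *)
From HB Require Import structures.
From mathcomp Require Import all_boot all_order all_algebra.
From mathcomp Require Import generic_quotient ring_quotient boolp mpoly.

Set Implicit Arguments.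
Unset Strict Implicit.
Unset Printing Implicit Defensive.

Import Order.TTheory GRing.Theory Num.Theory.
Local Open Scope ring_scope.
Local Open Scope quotient_scope.

(* V is the direct sum over i : I of the images of the pairwise orthogonal
   projections gproj i; each x has only finitely many nonzero components. *)
Record grading (I : eqType) (V : zmodType) := Grading {
  gproj :> I -> V -> V;
  gprojB : forall i x y, gproj i (x - y) = gproj i x - gproj i y;
  gproj_orth : forall i j x, gproj i (gproj j x) = if i == j then gproj j x else 0;
  gproj_sum : forall x, exists2 s : seq I, uniq s & x = \sum_(i <- s) gproj i x
}.

Definition gcomp (I : eqType) (V : zmodType) (G : grading I V) (i : I) : {pred V} :=
  [pred x | G i x == x].

Section GradingTheory.
Variables (I : eqType) (V : zmodType) (G : grading I V).

Lemma gproj0 i : G i 0 = 0.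
Proof. by rewrite -{1}(subrr 0) gprojB subrr. Qed.

Lemma gprojN i x : G i (- x) = - G i x.
Proof. by rewrite -(add0r (- x)) gprojB gproj0 add0r. Qed.

Lemma gprojD i x y : G i (x + y) = G i x + G i y.
Proof. by rewrite -[y in LHS]opprK gprojB gprojN opprK. Qed.

Lemma gproj_bigsum J (s : seq J) (P : pred J) F i :
  G i (\sum_(j <- s | P j) F j) = \sum_(j <- s | P j) G i (F j).
Proof. exact: (big_morph (G i) (gprojD i) (gproj0 i)). Qed.

Lemma gcompP i x : reflect (G i x = x) (x \in gcomp G i).
Proof. exact: eqP. Qed.

Lemma gproj_in i x : G i x \in gcomp G i.
Proof. by apply/gcompP; rewrite gproj_orth eqxx. Qed.

Lemma gproj_neq i j x : x \in gcomp G i -> j != i -> G j x = 0.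
Proof. by move=> /gcompP <- /negPf ij; rewrite gproj_orth ij. Qed.

Lemma gcomp0 i : 0 \in gcomp G i.
Proof. by apply/gcompP; rewrite gproj0. Qed.

Lemma gcompD i x y : x \in gcomp G i -> y \in gcomp G i -> x + y \in gcomp G i.
Proof. by move=> /gcompP Hx /gcompP Hy; apply/gcompP; rewrite gprojD Hx Hy. Qed.
End GradingTheory.

Record gralg (k : fieldType) := GrAlg {
  ga_alg :> algType k;
  ga_gr : grading nat ga_alg;
  ga_scalar : forall c : k, c%:A \in gcomp ga_gr 0%N;
  ga_mul : forall i j a b,
    a \in gcomp ga_gr i -> b \in gcomp ga_gr j -> a * b \in gcomp ga_gr (i + j)%N
}.

(* A Z-graded left module over a graded k-algebra; k acts through c |-> c%:A. *)
Record grmod (k : fieldType) (A : gralg k) := GrMod {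
  gm_mod :> lmodType A;
  gm_gr : grading int gm_mod;
  gm_act : forall i j (a : A) x,
    a \in gcomp (ga_gr A) i -> x \in gcomp gm_gr j ->
    a *: x \in gcomp gm_gr (i%:Z + j)
}.

Definition hcomp (k : fieldType) (A : gralg k) (M : grmod A) (n : int) : {pred M} :=
  gcomp (gm_gr M) n.
Arguments hcomp {k A} M n.

Definition gr_iso (k : fieldType) (A : gralg k) (M N : grmod A) : Prop :=
  exists f : {linear M -> N},
    bijective f /\ forall n x, x \in hcomp M n -> f x \in hcomp N n.

Section GrModTheory.
Variables (k : fieldType) (A : gralg k) (M : grmod A).
Local Notation pa := (ga_gr A).
Local Notation pm := (gm_gr M).

Lemma act_low (a : A) (x : M) (n : int) :
  (forall j, (j < n)%R -> pm j x = 0) ->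
  forall j, (j < n)%R -> pm j (a *: x) = 0.
Proof.
move=> Hx j jn.
have [s _ ->] := gproj_sum pa a; have [s' _ Ex] := gproj_sum pm x.
rewrite scaler_suml gproj_bigsum big1_seq // => i _.
rewrite {1}Ex scaler_sumr gproj_bigsum big1_seq // => l _.
have [ln|nl] := ltP l n; first by rewrite Hx // scaler0 gproj0.
apply: (@gproj_neq _ _ pm (i%:Z + l)); first by apply: gm_act; apply: gproj_in.
apply: contraTneq jn => ->; rewrite -leNgt.
by apply: (le_trans nl); rewrite lerDr.
Qed.
End GrModTheory.

Record grsub (k : fieldType) (A : gralg k) (M : grmod A) := GrSub {
  gs_mem :> M -> bool;
  gs_closed : submod_closed gs_mem;
  gs_graded : forall n x, x \in gs_mem -> gm_gr M n x \in gs_mem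
}.

Section SubQuot.
Variables (k : fieldType) (A : gralg k) (M : grmod A) (N : grsub M).
Local Notation pm := (gm_gr M).

Lemma gs_closed_semi : subsemimod_closed (gs_mem N).
Proof. exact: GRing.submod_closed_semi (gs_closed N). Qed.

HB.instance Definition _ := GRing.isSubmodClosed.Build A M (gs_mem N) gs_closed_semi.

Record subm := SubM { subm_val : M; _ : subm_val \in gs_mem N }.
HB.instance Definition _ := [isSub for subm_val].
HB.instance Definition _ := [Choice of subm by <:].
HB.instance Definition _ := [SubChoice_isSubLmodule of subm by <:].

Definition quotm := Quotient.quot (GRing.ZmodClosed.clone M (gs_mem N) _).
HB.instance Definition _ := GRing.Zmodule.on quotm.
HB.instance Definition _ := EqQuotient.on quotm.

Definition quotm_scale (a : A) (x : quotm) : quotm := \pi_quotm (a *: repr x).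

Lemma quotm_pi (x y : M) : \pi_quotm x = \pi_quotm y <-> x - y \in gs_mem N.
Proof.
by rewrite Quotient.idealrBE; split => [->|/eqP].
Qed.

Lemma quotm_pi_scale a x : quotm_scale a (\pi_quotm x) = \pi_quotm (a *: x).
Proof.
apply/quotm_pi; rewrite -scalerBr rpredZ //.
by apply/quotm_pi; rewrite reprK.
Qed.

Lemma quotm_piD (x y : M) : \pi_quotm (x + y) = \pi_quotm x + \pi_quotm y.
Proof. exact: (@Quotient.pi_add M (GRing.ZmodClosed.clone M (gs_mem N) _)). Qed.

Lemma quotm_piN (x : M) : \pi_quotm (- x) = - \pi_quotm x.
Proof. exact: (@Quotient.pi_opp M (GRing.ZmodClosed.clone M (gs_mem N) _)). Qed.

Lemma quotm_surj (v : quotm) : exists x, v = \pi_quotm x.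
Proof. by exists (repr v); rewrite reprK. Qed.

Lemma quotm_scaleA a b v : quotm_scale a (quotm_scale b v) = quotm_scale (a * b) v.
Proof. by case: (quotm_surj v) => x ->; rewrite !quotm_pi_scale scalerA. Qed.

Lemma quotm_scale1 : left_id 1 quotm_scale.
Proof. by move=> v; case: (quotm_surj v) => x ->; rewrite quotm_pi_scale scale1r. Qed.

Lemma quotm_scaleDr : right_distributive quotm_scale +%R.
Proof.
move=> a u v; case: (quotm_surj u) => x ->; case: (quotm_surj v) => y ->.
by rewrite -quotm_piD !quotm_pi_scale scalerDr quotm_piD.
Qed.

Lemma quotm_scaleDl v : {morph quotm_scale^~ v : a b / a + b}.
Proof.
by move=> a b; case: (quotm_surj v) => x ->; rewrite !quotm_pi_scale scalerDl quotm_piD.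
Qed.

HB.instance Definition _ := GRing.Zmodule_isLmodule.Build A quotm
  quotm_scaleA quotm_scale1 quotm_scaleDr quotm_scaleDl.

Lemma subm_mem (x : subm) : subm_val x \in gs_mem N.
Proof. exact: valP. Qed.

Definition subm_proj (n : int) (x : subm) : subm := SubM (gs_graded n (subm_mem x)).

Lemma subm_projB n x y : subm_proj n (x - y) = subm_proj n x - subm_proj n y.
Proof. by apply: val_inj; rewrite /= gprojB. Qed.

Lemma subm_proj_orth i j x :
  subm_proj i (subm_proj j x) = if i == j then subm_proj j x else 0.
Proof. by apply: val_inj; rewrite /= gproj_orth; case: eqP. Qed.

Lemma subm_proj_sum x : exists2 s : seq int, uniq s & x = \sum_(i <- s) subm_proj i x.
Proof.
have [s us Ex] := gproj_sum pm (val x); exists s => //.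
apply: val_inj; rewrite {1}Ex.
by elim: s {us Ex} => [|i s IH]; rewrite ?big_nil // !big_cons /= IH.
Qed.

Definition subm_gr := Grading subm_projB subm_proj_orth subm_proj_sum.

Lemma subm_act i j (a : A) x :
  a \in gcomp (ga_gr A) i -> x \in gcomp subm_gr j -> a *: x \in gcomp subm_gr (i%:Z + j).
Proof.
move=> Ha /gcompP Hx; apply/gcompP; apply: val_inj => /=.
by apply/gcompP/gm_act => //; apply/gcompP; rewrite -[in RHS]Hx.
Qed.

Definition gr_sub : grmod A := GrMod subm_act.

Definition quotm_proj (n : int) (v : quotm) : quotm := \pi_quotm (pm n (repr v)).

Lemma quotm_proj_pi n x : quotm_proj n (\pi_quotm x) = \pi_quotm (pm n x).
Proof.
apply/quotm_pi; rewrite -gprojB; apply: gs_graded.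
by apply/quotm_pi; rewrite reprK.
Qed.

Lemma quotm_projB n u v : quotm_proj n (u - v) = quotm_proj n u - quotm_proj n v.
Proof.
case: (quotm_surj u) => x ->; case: (quotm_surj v) => y ->.
by rewrite -quotm_piN -quotm_piD !quotm_proj_pi gprojB quotm_piD quotm_piN.
Qed.

Lemma quotm_pi0 : \pi_quotm 0 = 0.
Proof. by rewrite -[in LHS](subrr 0) quotm_piD quotm_piN subrr. Qed.

Lemma quotm_proj_orth i j v :
  quotm_proj i (quotm_proj j v) = if i == j then quotm_proj j v else 0.
Proof.
case: (quotm_surj v) => x ->; rewrite !quotm_proj_pi gproj_orth.
by case: eqP => // _; rewrite quotm_pi0.
Qed.

Lemma quotm_proj_sum v : exists2 s : seq int, uniq s & v = \sum_(i <- s) quotm_proj i v.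
Proof.
case: (quotm_surj v) => x ->; have [s us Ex] := gproj_sum pm x; exists s => //.
rewrite {1}Ex (big_morph (\pi_quotm) quotm_piD quotm_pi0).
by apply: eq_bigr => i _; rewrite quotm_proj_pi.
Qed.

Definition quotm_gr := Grading quotm_projB quotm_proj_orth quotm_proj_sum.

Lemma quotm_act i j (a : A) v :
  a \in gcomp (ga_gr A) i -> v \in gcomp quotm_gr j ->
  a *: v \in gcomp quotm_gr (i%:Z + j).
Proof.
case: (quotm_surj v) => x -> Ha /gcompP Hx; apply/gcompP; rewrite -Hx.
have Ez y : a *: (\pi_quotm y : quotm) = \pi_quotm (a *: y) by exact: quotm_pi_scale.
change (quotm_proj (i%:Z + j) (a *: quotm_proj j (\pi_quotm x)) =
        a *: quotm_proj j (\pi_quotm x)).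
rewrite quotm_proj_pi Ez quotm_proj_pi; congr (\pi_quotm _).
by apply/gcompP/gm_act => //; apply: gproj_in.
Qed.

Definition gr_quot : grmod A := GrMod quotm_act.
End SubQuot.

Section ShiftTruncate.
Variables (k : fieldType) (A : gralg k) (M : grmod A) (n : int).
Local Notation pm := (gm_gr M).

(* M[n], with M[n]_m = M_(n + m) *)
Definition shift_proj (m : int) (x : M) : M := pm (n + m) x.

Lemma shift_projB m x y : shift_proj m (x - y) = shift_proj m x - shift_proj m y.
Proof. exact: gprojB. Qed.

Lemma shift_proj_orth i j x :
  shift_proj i (shift_proj j x) = if i == j then shift_proj j x else 0.
Proof. by rewrite /shift_proj gproj_orth (can_eq (addKr n)). Qed.

Lemma shift_proj_sum x : exists2 s : seq int, uniq s & x = \sum_(i <- s) shift_proj i x.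
Proof.
have [s us Ex] := gproj_sum pm x; exists [seq i - n | i <- s].
  by rewrite map_inj_uniq //; apply: addIr.
by rewrite big_map {1}Ex; apply: eq_bigr => i _; rewrite /shift_proj subrKC.
Qed.

Definition shift_gr := Grading shift_projB shift_proj_orth shift_proj_sum.

Lemma shift_act i j (a : A) x :
  a \in gcomp (ga_gr A) i -> x \in gcomp shift_gr j -> a *: x \in gcomp shift_gr (i%:Z + j).
Proof.
move=> Ha Hx; apply/gcompP; rewrite /= /shift_proj addrCA.
exact/gcompP/gm_act.
Qed.

Definition gr_shift : grmod A := GrMod shift_act.

(* the submodule M_(>= n) *)
Definition ge_mem (x : M) : bool := `[< forall j : int, (j < n)%R -> pm j x = 0 >].

Lemma ge_closed : submod_closed ge_mem.
Proof.
split=> [|a x y /asboolP Hx /asboolP Hy]; apply/asboolP => j jn; first exact: gproj0.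
by rewrite gprojD (act_low _ Hx) // Hy // addr0.
Qed.

Lemma ge_graded j x : x \in ge_mem -> pm j x \in ge_mem.
Proof.
move=> /asboolP Hx; apply/asboolP => l ln; rewrite gproj_orth.
by case: eqP => // <-; apply: Hx.
Qed.

Definition gr_ge_sub : grsub M := GrSub ge_closed ge_graded.
Definition gr_ge : grmod A := gr_sub gr_ge_sub.
End ShiftTruncate.

(* M_(<= n) = M / M_(>= n + 1) *)
Definition gr_le (k : fieldType) (A : gralg k) (M : grmod A) (n : int) : grmod A :=
  gr_quot (gr_ge_sub M (n + 1)).

Section Regular.
Variables (k : fieldType) (A : gralg k).
Local Notation pa := (ga_gr A).

Definition reg_proj (n : int) (x : A^o) : A^o := if n is Posz m then pa m x else 0.

Lemma reg_projB n x y : reg_proj n (x - y) = reg_proj n x - reg_proj n y.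
Proof. by case: n => m /=; [apply: gprojB | rewrite subrr]. Qed.

Lemma reg_proj_orth i j x :
  reg_proj i (reg_proj j x) = if i == j then reg_proj j x else 0.
Proof.
case: i j => [i|i] [j|j] //=; rewrite ?gproj_orth ?gproj0 //.
by case: ifP.
Qed.

Lemma reg_proj_sum x : exists2 s : seq int, uniq s & x = \sum_(i <- s) reg_proj i x.
Proof.
have [s us Ex] := gproj_sum pa x; exists (map Posz s).
  by rewrite map_inj_uniq // => i j [].
by rewrite big_map.
Qed.

Definition reg_gr := Grading reg_projB reg_proj_orth reg_proj_sum.

Lemma reg_act i j (a : A) (x : A^o) :
  a \in gcomp pa i -> x \in gcomp reg_gr j -> a *: x \in gcomp reg_gr (i%:Z + j).
Proof.
case: j => [j|j] Ha /gcompP /= Hx.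
  by apply/gcompP => /=; apply/gcompP/ga_mul => //; apply/gcompP.
by rewrite -Hx scaler0; apply: gcomp0.
Qed.

(* A as a graded left A-module; its graded submodules are the graded left ideals *)
Definition gr_reg : grmod A := GrMod reg_act.
End Regular.

Record grhom (k : fieldType) (A B : gralg k) := GrHom {
  gh_fun :> {lrmorphism A -> B};
  gh_homog : forall n a, a \in gcomp (ga_gr A) n -> gh_fun a \in gcomp (ga_gr B) n
}.

(* Restriction of scalars along h : A -> B. *)
Section Restriction.
Variables (k : fieldType) (A B : gralg k) (h : grhom A B) (M : grmod B).

Definition restrm : Type := M.
HB.instance Definition _ := GRing.Zmodule.on restrm.

Definition restrm_scale (a : A) (x : restrm) : restrm := h a *: (x : M).

Lemma restrm_scaleA a b v : restrm_scale a (restrm_scale b v) = restrm_scale (a * b) v.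
Proof. by rewrite /restrm_scale scalerA rmorphM. Qed.
Lemma restrm_scale1 : left_id 1 restrm_scale.
Proof. by move=> v; rewrite /restrm_scale rmorph1 scale1r. Qed.
Lemma restrm_scaleDr : right_distributive restrm_scale +%R.
Proof. by move=> a u v; apply: scalerDr. Qed.
Lemma restrm_scaleDl v : {morph restrm_scale^~ v : a b / a + b}.
Proof. by move=> a b; rewrite /restrm_scale raddfD scalerDl. Qed.

HB.instance Definition _ := GRing.Zmodule_isLmodule.Build A restrm
  restrm_scaleA restrm_scale1 restrm_scaleDr restrm_scaleDl.

Definition restrm_gr : grading int restrm :=
  Grading (gprojB (gm_gr M)) (gproj_orth (gm_gr M)) (gproj_sum (gm_gr M)).

Lemma restrm_act i j (a : A) (x : restrm) :
  a \in gcomp (ga_gr A) i -> x \in gcomp restrm_gr j ->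
  a *: x \in gcomp restrm_gr (i%:Z + j).
Proof. by move=> Ha Hx; apply: (@gm_act _ _ M) => //; apply: gh_homog. Qed.

Definition gr_restr : grmod A := GrMod restrm_act.
End Restriction.

Definition one_dim (k : fieldType) (A : gralg k) (M : grmod A) (n : int) : Prop :=
  exists2 x, x \in hcomp M n & x != 0 /\
    forall y, y \in hcomp M n -> exists c : k, y = c%:A *: x.

(* cyclic and generated in degree 0, which forces M_n = 0 for n < 0 *)
Definition is_point_module (k : fieldType) (A : gralg k) (M : grmod A) : Prop :=
  (exists2 x, x \in hcomp M 0 & forall y, exists a : A, y = a *: x) /\
  forall n : nat, one_dim M n.

Definition is_shifted_point_module (k : fieldType) (A : gralg k) (M : grmod A) : Prop :=
  exists (n : int) (N : grmod A), is_point_module N /\ gr_iso M (gr_shift N n).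

(* For a point module M this is the left ideal I with M isomorphic to A / I. *)
Definition point_ideal (k : fieldType) (A : gralg k) (M : grmod A) (a : A) : Prop :=
  forall x, x \in hcomp M 0 -> a *: x = 0.

Section Projective.
Variable k : fieldType.

(* closed points of P^n, as lines through the origin of k^(n+1) *)
Record ppoint (n : nat) := PPoint {
  pline :> {vspace 'rV[k]_n.+1};
  _ : \dim pline == 1%N
}.
HB.instance Definition _ n := [isSub for @pline n].
HB.instance Definition _ n := [Choice of ppoint n by <:].

Definition vanishes (n : nat) (f : {mpoly k[n.+1]}) (d : ppoint n) : Prop :=
  forall v, v \in pline d -> f.@[v 0] = 0.

(* m_d, the ideal generated by the homogeneous polynomials vanishing at d:
   its elements are those all of whose homogeneous components vanish at d. *)
Definition point_mx (n : nat) (d : ppoint n) (f : {mpoly k[n.+1]}) : Prop :=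
  forall i : nat, vanishes (pihomog mdeg i f) d.

(* the square of m_d in the commutative polynomial ring *)
Definition point_mx2 (n : nat) (d : ppoint n) (f : {mpoly k[n.+1]}) : Prop :=
  exists2 s : seq ({mpoly k[n.+1]} * {mpoly k[n.+1]}),
    (forall p, p \in s -> point_mx d p.1 /\ point_mx d p.2) &
    f = \sum_(p <- s) p.1 * p.2.

(* Near every point d0 the map is given by homogeneous polynomials of the same
   degree without common zero at d0.  By continuity they compute phi wherever
   they do not all vanish; where they do, the last condition is void. *)
Definition is_morphism (m n : nat) (phi : ppoint m -> ppoint n) : Prop :=
  forall d0, exists (e : nat) (F : 'I_n.+1 -> {mpoly k[m.+1]}),
    [/\ forall j, F j \is e.-homog,
        exists j, ~ vanishes (F j) d0 &
        forall d v, v \in pline d -> (\row_j (F j).@[v 0]) \in pline (phi d)].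

Record proj_aut (n : nat) := ProjAut {
  pa_fun :> ppoint n -> ppoint n;
  pa_inv : ppoint n -> ppoint n;
  pa_funK : cancel pa_fun pa_inv;
  pa_invK : cancel pa_inv pa_fun;
  pa_fun_morphism : is_morphism pa_fun;
  pa_inv_morphism : is_morphism pa_inv
}.

(* phi^(-i) c *)
Definition orbit_pt (n : nat) (phi : proj_aut n) (c : ppoint n) (i : int) : ppoint n :=
  match i with
  | Posz j => iter j (pa_inv phi) c
  | Negz j => iter j.+1 phi c
  end.

Definition zariski_closed (n : nat) (X : ppoint n -> Prop) : Prop :=
  exists2 E : {mpoly k[n.+1]} -> Prop,
    (forall f, E f -> exists e : nat, f \is e.-homog) &
    (forall d, X d <-> forall f, E f -> vanishes f d).

Definition finite_pts (n : nat) (X : ppoint n -> Prop) : Prop :=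
  exists s : seq (ppoint n), forall d, X d -> d \in s.

Definition critically_dense (n : nat) (C : ppoint n -> Prop) : Prop :=
  ~ finite_pts C /\
  forall X, zariski_closed X -> (exists d, ~ X d) -> finite_pts (fun d => C d /\ X d).

Definition critical_density (n : nat) (phi : proj_aut n) (c : ppoint n) : Prop :=
  injective (orbit_pt phi c) /\
  critically_dense (fun d => exists i, d = orbit_pt phi c i).

Record graut (n : nat) := GrAut {
  gau_fun :> {lrmorphism {mpoly k[n]} -> {mpoly k[n]}};
  gau_bij : bijective gau_fun;
  gau_homog : forall e f, f \is e.-homog -> gau_fun f \is e.-homog
}.

(* m_(phi(d)) = psi^(-1)(m_d) *)
Definition induces (n : nat) (psi : graut n.+1) (phi : proj_aut n) : Prop :=
  forall d f, point_mx (phi d) f <-> point_mx d (psi f).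

End Projective.

Section Twist.
Variables (k : fieldType) (n : nat) (psi : graut k n).
Local Notation U := {mpoly k[n]}.
Implicit Types f g h : U.

(* f g = psi^j(f) o g for g in U_j (lemma twist_mul_homog), extended additively in g *)
Definition twist_mul f g : U :=
  \sum_(j < msize g) iter j psi f * pihomog mdeg j g.

Lemma pihomog_big j g : (msize g <= j)%N -> pihomog mdeg j g = 0.
Proof.
move=> gj; rewrite pihomogE big_seq_cond big1 // => m /andP[mg /eqP mj].
by move: (msize_mdeg_lt mg); rewrite mj ltnNge gj.
Qed.

Lemma twist_mulE K f g : (msize g <= K)%N ->
  twist_mul f g = \sum_(j < K) iter j psi f * pihomog mdeg j g.
Proof.
move=> gK; rewrite /twist_mul.
rewrite (big_ord_widen K (fun j => iter j psi f * pihomog mdeg j g) gK).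
rewrite [RHS](bigID (fun i : 'I_K => (i < msize g)%N)) /= [X in _ = _ + X]big1 ?addr0 //.
by move=> i; rewrite -leqNgt => /pihomog_big ->; rewrite mulr0.
Qed.

Lemma twist_mul_homog j f g : g \is j.-homog -> twist_mul f g = iter j psi f * g.
Proof.
move=> gj; rewrite (@twist_mulE (maxn (msize g) j.+1)) ?leq_maxl //.
have jK : (j < maxn (msize g) j.+1)%N by rewrite leq_max leqnn orbT.
rewrite (bigD1 (Ordinal jK)) //= pihomog_dE // big1 ?addr0 // => i ij.
rewrite (pihomog_ne0 _ gj) ?mulr0 //.
by apply: contra ij => /eqP ij; apply/eqP/val_inj.
Qed.

Lemma iterB j f g : iter j psi (f - g) = iter j psi f - iter j psi g.
Proof. by elim: j => [|j IH] //; rewrite !iterS IH raddfB. Qed.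
Lemma iterM j f g : iter j psi (f * g) = iter j psi f * iter j psi g.
Proof. by elim: j => [|j IH] //; rewrite !iterS IH rmorphM. Qed.
Lemma iter1 j : iter j psi 1 = 1.
Proof. by elim: j => [|j IH] //; rewrite !iterS IH rmorph1. Qed.
Lemma iterZ j c f : iter j psi (c *: f) = c *: iter j psi f.
Proof. by elim: j => [|j IH] //; rewrite !iterS IH linearZ. Qed.
Lemma iter_homog j e f : f \is e.-homog -> iter j psi f \is e.-homog.
Proof. by move=> fe; elim: j => //= j; apply: gau_homog. Qed.
Lemma iter0 j : iter j psi 0 = 0.
Proof. by rewrite -{1}(subrr 0) iterB subrr. Qed.
Lemma iterDp j f g : iter j psi (f + g) = iter j psi f + iter j psi g.
Proof. by elim: j => [|j IH] //; rewrite !iterS IH raddfD. Qed.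

Lemma twist_mulDl : left_distributive twist_mul +%R.
Proof.
move=> f g h; rewrite /twist_mul -big_split /=.
by apply: eq_bigr => i _; rewrite iterDp mulrDl.
Qed.

Lemma twist_mulDr : right_distributive twist_mul +%R.
Proof.
move=> f g h; set K := maxn (msize (g + h)) (maxn (msize g) (msize h)).
rewrite !(@twist_mulE K) ?leq_max ?leqnn ?orbT // -big_split /=.
by apply: eq_bigr => i _; rewrite raddfD mulrDr.
Qed.

Lemma twist_mul0r f : twist_mul f 0 = 0.
Proof. by apply: (addrI (twist_mul f 0)); rewrite -twist_mulDr !addr0. Qed.
Lemma twist_mul0l f : twist_mul 0 f = 0.
Proof. by apply: (addrI (twist_mul 0 f)); rewrite -twist_mulDl !addr0. Qed.

Lemma homog_parts g : g = \sum_(i < msize g) pihomog mdeg i g.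
Proof. exact: pihomog_partitionE. Qed.

Lemma twist_mulA : associative twist_mul.
Proof.
move=> f g h.
have Sr a (J : finType) (F : J -> U) :
    twist_mul a (\sum_j F j) = \sum_j twist_mul a (F j).
  exact: (big_morph (twist_mul a) (twist_mulDr a) (twist_mul0r a)).
have Sl a (J : finType) (F : J -> U) :
    twist_mul (\sum_j F j) a = \sum_j twist_mul (F j) a.
  exact: (big_morph (twist_mul^~ a) (fun x y => twist_mulDl x y a) (twist_mul0l a)).
rewrite (homog_parts h) [twist_mul g _]Sr Sr [RHS]Sr; apply: eq_bigr => l _.
rewrite (homog_parts g) [X in twist_mul f X = _]Sl [LHS]Sr.
rewrite [X in _ = twist_mul X _]Sr [RHS]Sl; apply: eq_bigr => j _.
have hl := pihomogP mdeg l h; have gj := pihomogP mdeg j g.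
rewrite (twist_mul_homog _ hl) (twist_mul_homog _ gj) (twist_mul_homog _ hl).
rewrite (twist_mul_homog _ (dhomogM (iter_homog l gj) hl)).
by rewrite addnC iterD iterM mulrA.
Qed.

Lemma twist_mul1l : left_id 1 twist_mul.
Proof.
move=> g; rewrite {2}(homog_parts g); apply: eq_bigr => j _.
by rewrite iter1 mul1r.
Qed.
Lemma twist_mul1r : right_id 1 twist_mul.
Proof. by move=> f; rewrite (twist_mul_homog _ (dhomog1 _ _)) mulr1. Qed.

Definition twist : Type := U.
HB.instance Definition _ := GRing.Lmodule.copy twist U.

Lemma twist_one_neq0 : (1 : U) != 0.
Proof. exact: oner_neq0. Qed.

HB.instance Definition _ := GRing.Zmodule_isNzRing.Build twist
  twist_mulA twist_mul1l twist_mul1r twist_mulDl twist_mulDr twist_one_neq0.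

Lemma twist_scaleAl (c : k) (f g : twist) : c *: (f * g) = (c *: f : twist) * g.
Proof.
change (c *: twist_mul f g = twist_mul (c *: (f : U)) g).
rewrite /twist_mul scaler_sumr.
by apply: eq_bigr => i _; rewrite iterZ scalerAl.
Qed.
HB.instance Definition _ := GRing.Lmodule_isLalgebra.Build k twist twist_scaleAl.

Lemma twist_scaleAr (c : k) (f g : twist) : c *: (f * g) = f * (c *: g).
Proof.
change (c *: twist_mul f g = twist_mul f (c *: (g : U))).
rewrite (@twist_mulE (msize (c *: (g : U)) + msize (g : U))%N) ?leq_addl //.
rewrite (@twist_mulE (msize (c *: (g : U)) + msize (g : U))%N) ?leq_addr //.
rewrite scaler_sumr; apply: eq_bigr => i _.
by rewrite linearZ /= scalerAr.
Qed.
HB.instance Definition _ := GRing.Lalgebra_isAlgebra.Build k twist twist_scaleAr.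

Definition twist_proj (i : nat) (f : twist) : twist := pihomog mdeg i (f : U).

Lemma twist_projB i (f g : twist) : twist_proj i (f - g) = twist_proj i f - twist_proj i g.
Proof. exact: (raddfB (pihomog mdeg i)). Qed.

Lemma twist_proj_orth i j (f : twist) :
  twist_proj i (twist_proj j f) = if i == j then twist_proj j f else 0.
Proof.
rewrite /twist_proj; case: eqP => [->|/eqP ij]; first exact: pihomog_id.
by apply: pihomog_ne0 (pihomogP _ _ _); rewrite eq_sym.
Qed.

Lemma twist_proj_sum (f : twist) :
  exists2 s : seq nat, uniq s & f = \sum_(i <- s) twist_proj i f.
Proof.
exists (index_iota 0 (msize (f : U))); first exact: iota_uniq.
by rewrite big_mkord; apply: homog_parts.
Qed.

Definition twist_gr := Grading twist_projB twist_proj_orth twist_proj_sum.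

Lemma twist_compP i (f : twist) : (f \in gcomp twist_gr i) = ((f : U) \is i.-homog).
Proof. by rewrite homog_piE. Qed.

Lemma twist_scalar (c : k) : (c%:A : twist) \in gcomp twist_gr 0%N.
Proof. by rewrite twist_compP rpredZ //; apply: dhomog1. Qed.

Lemma twist_mul_gr i j (a b : twist) :
  a \in gcomp twist_gr i -> b \in gcomp twist_gr j -> a * b \in gcomp twist_gr (i + j)%N.
Proof.
rewrite !twist_compP => ai bj; change (twist_mul a b \is (i + j).-homog).
rewrite (twist_mul_homog _ bj).
exact: dhomogM (iter_homog j ai) bj.
Qed.

Definition twist_alg : gralg k := GrAlg twist_scalar twist_mul_gr.

End Twist.

(* The graded subalgebra generated by a set V of homogeneous elements. *)
Inductive gen_subalg (k : fieldType) (A : algType k) (V : A -> Prop) : A -> Prop :=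
| gen_in a : V a -> gen_subalg V a
| gen_scalar (c : k) : gen_subalg V c%:A
| gen_add a b : gen_subalg V a -> gen_subalg V b -> gen_subalg V (a + b)
| gen_mul a b : gen_subalg V a -> gen_subalg V b -> gen_subalg V (a * b).

Section GenSub.
Variables (k : fieldType) (A : gralg k) (V : A -> Prop).
Hypothesis homV : forall a, V a -> exists i, a \in gcomp (ga_gr A) i.
Local Notation pa := (ga_gr A).

Definition gen_mem (a : A) : bool := `[< gen_subalg V a >].

Lemma gen_memP a : reflect (gen_subalg V a) (a \in gen_mem).
Proof. exact: asboolP. Qed.

Lemma gen0 : gen_subalg V 0.
Proof. by rewrite -(scale0r 1); apply: gen_scalar. Qed.

Lemma gen_sum (J : eqType) (s : seq J) F :
  (forall j, j \in s -> gen_subalg V (F j)) -> gen_subalg V (\sum_(j <- s) F j).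
Proof.
move=> H; rewrite big_seq; elim/big_ind: _ => [|a b|//]; first exact: gen0.
exact: gen_add.
Qed.

Lemma gen_closed : GRing.subsemialg_closed gen_mem.
Proof.
split.
- by apply/gen_memP; rewrite -(scale1r 1); apply: gen_scalar.
- split; first exact/gen_memP/gen0.
  by move=> a b /gen_memP ? /gen_memP ?; apply/gen_memP; apply: gen_add.
- move=> c a /gen_memP ?; apply/gen_memP.
  by rewrite -[a]mul1r scalerAl; apply: gen_mul => //; apply: gen_scalar.
- by move=> a b /gen_memP ? /gen_memP ?; apply/gen_memP; apply: gen_mul.
Qed.

HB.instance Definition _ := GRing.isSubalgClosed.Build k A gen_mem gen_closed.

Record gensub := GenSub { gensub_val : A; _ : gensub_val \in gen_mem }.
HB.instance Definition _ := [isSub for gensub_val].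
HB.instance Definition _ := [Choice of gensub by <:].
HB.instance Definition _ := [SubChoice_isSubAlgebra of gensub by <:].

Lemma gen_mem_val (x : gensub) : gensub_val x \in gen_mem.
Proof. exact: valP. Qed.

Lemma gen_proj i a : gen_subalg V a -> gen_subalg V (pa i a).
Proof.
have H j b : b \in gcomp pa j -> gen_subalg V b -> forall l, gen_subalg V (pa l b).
  move=> bj Vb l; have [<-|/eqP jl] := (j =P l); first by rewrite (gcompP _ _ _ bj).
  by rewrite (gproj_neq bj) 1?eq_sym //; apply: gen0.
move=> Va; elim: Va i => {a} [a Va|c|a b _ IHa _ IHb|a b _ IHa _ IHb] i.
- by have [j aj] := homV Va; apply: H aj _ i; apply: gen_in.
- by apply: H (ga_scalar A c) _ i; apply: gen_scalar.
- by rewrite gprojD; apply: gen_add.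
have [s _ ->] := gproj_sum pa a; have [s' _ ->] := gproj_sum pa b.
rewrite mulr_suml gproj_bigsum; apply: gen_sum => j _.
rewrite mulr_sumr gproj_bigsum; apply: gen_sum => l _.
apply: (H (j + l)%N); first by apply: ga_mul; apply: gproj_in.
exact: gen_mul.
Qed.

Lemma gen_mem_proj i (x : gensub) : pa i (gensub_val x) \in gen_mem.
Proof. by apply/gen_memP/gen_proj/gen_memP; apply: gen_mem_val. Qed.

Definition gensub_proj i (x : gensub) : gensub := GenSub (gen_mem_proj i x).

Lemma gensub_projB i x y : gensub_proj i (x - y) = gensub_proj i x - gensub_proj i y.
Proof. by apply: val_inj; rewrite /= gprojB. Qed.

Lemma gensub_proj_orth i j x :
  gensub_proj i (gensub_proj j x) = if i == j then gensub_proj j x else 0.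
Proof. by apply: val_inj; rewrite /= gproj_orth; case: eqP. Qed.

Lemma gensub_proj_sum x : exists2 s : seq nat, uniq s & x = \sum_(i <- s) gensub_proj i x.
Proof.
have [s us Ex] := gproj_sum pa (val x); exists s => //.
apply: val_inj; rewrite {1}Ex.
by elim: s {us Ex} => [|i s IH]; rewrite ?big_nil // !big_cons /= IH.
Qed.

Definition gensub_gr := Grading gensub_projB gensub_proj_orth gensub_proj_sum.

Lemma gensub_compP i (x : gensub) :
  (x \in gcomp gensub_gr i) = (gensub_val x \in gcomp pa i).
Proof. by []. Qed.

Lemma gensub_scalar (c : k) : (c%:A : gensub) \in gcomp gensub_gr 0%N.
Proof. by rewrite gensub_compP; apply: (ga_scalar A c). Qed.

Lemma gensub_mul i j (x y : gensub) :
  x \in gcomp gensub_gr i -> y \in gcomp gensub_gr j -> x * y \in gcomp gensub_gr (i + j)%N.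
Proof. by rewrite !gensub_compP; apply: ga_mul. Qed.

Definition gensub_alg : gralg k := GrAlg gensub_scalar gensub_mul.

Definition gensub_fun (x : gensub_alg) : A := gensub_val (x : gensub).

Lemma gensub_fun_zmod : zmod_morphism gensub_fun. Proof. by []. Qed.
Lemma gensub_fun_monoid : monoid_morphism gensub_fun. Proof. by []. Qed.
Lemma gensub_fun_scalable : scalable gensub_fun. Proof. by []. Qed.

HB.instance Definition _ :=
  GRing.isZmodMorphism.Build gensub_alg A gensub_fun gensub_fun_zmod.
HB.instance Definition _ :=
  GRing.isMonoidMorphism.Build gensub_alg A gensub_fun gensub_fun_monoid.
HB.instance Definition _ :=
  GRing.isScalable.Build k gensub_alg A *:%R gensub_fun gensub_fun_scalable.

Lemma gensub_fun_homog i (x : gensub_alg) :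
  x \in gcomp (ga_gr gensub_alg) i -> gensub_fun x \in gcomp pa i.
Proof. by []. Qed.

Definition gensub_incl : grhom gensub_alg A := GrHom gensub_fun_homog.

End GenSub.

Section PointIdeals.
Variables (k : fieldType) (n : nat) (psi : graut k n.+1) (d : ppoint k n).
Local Notation U := {mpoly k[n.+1]}.
Local Notation S := (twist_alg psi).

Lemma point_mx0 : point_mx d 0.
Proof. by move=> i v _; rewrite raddf0 meval0. Qed.

Lemma point_mxD f g : point_mx d f -> point_mx d g -> point_mx d (f + g).
Proof. by move=> Hf Hg i v dv; rewrite raddfD mevalD Hf // Hg // addr0. Qed.

Lemma point_mx_proj i f : point_mx d f -> point_mx d (pihomog mdeg i f).
Proof.
move=> Hf j v dv; have [ij|ij] := eqVneq i j; first by rewrite -ij pihomog_id Hf.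
by rewrite (pihomog_ne0 ij (pihomogP _ _ _)) meval0.
Qed.

Lemma point_mx_sum (J : finType) (F : J -> U) :
  (forall j, point_mx d (F j)) -> point_mx d (\sum_j F j).
Proof. by move=> H; elim/big_ind: _ => //; [apply: point_mx0 | apply: point_mxD]. Qed.

Lemma point_mx_homog i f : f \is i.-homog -> vanishes f d -> point_mx d f.
Proof.
move=> fi Hf j v dv; have [ij|ij] := eqVneq i j; first by rewrite -ij pihomog_dE // Hf.
by rewrite (pihomog_ne0 ij fi) meval0.
Qed.

Lemma point_mx_mul f g : point_mx d g -> point_mx d (f * g).
Proof.
move=> Hg; rewrite (homog_parts f) mulr_suml; apply: point_mx_sum => i.
rewrite [g]homog_parts mulr_sumr; apply: point_mx_sum => j.
apply: (point_mx_homog (dhomogM (pihomogP _ _ _) (pihomogP _ _ _))) => v dv.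
by rewrite mevalM (Hg j v dv) mulr0.
Qed.

Definition tw_mem (f : gr_reg S) : bool := `[< point_mx d (f : U) >].

Lemma tw_closed : submod_closed tw_mem.
Proof.
split=> [|a x y /asboolP Hx /asboolP Hy]; apply/asboolP; first exact: point_mx0.
apply: point_mxD => //; change (point_mx d (twist_mul psi a x)).
by apply: point_mx_sum => j; apply/point_mx_mul/point_mx_proj.
Qed.

Lemma tw_graded i f : f \in tw_mem -> gm_gr (gr_reg S) i f \in tw_mem.
Proof.
move=> /asboolP Hf; apply/asboolP; case: i => i; first exact: point_mx_proj.
exact: point_mx0.
Qed.

(* m_d as a graded left ideal of S *)
Definition tw_ideal : grsub (gr_reg S) := GrSub tw_closed tw_graded.

(* P(d) = S / m_d *)
Definition tw_point : grmod S := gr_quot tw_ideal.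
End PointIdeals.

Section GeneratedAlgebra.
Variables (k : fieldType) (n : nat) (psi : graut k n.+1) (c : ppoint k n).
Local Notation S := (twist_alg psi).

(* (m_c)_1 *)
Definition deg1_vanishing (f : S) : Prop :=
  f \in gcomp (ga_gr S) 1%N /\ vanishes (f : {mpoly k[n.+1]}) c.

Lemma deg1_homog f : deg1_vanishing f -> exists i, f \in gcomp (ga_gr S) i.
Proof. by case=> ? _; exists 1%N. Qed.

(* R = k<(m_c)_1>, with its inclusion into S *)
Definition R_alg : gralg k := gensub_alg deg1_homog.
Definition R_incl : grhom R_alg S := gensub_incl deg1_homog.

Definition R_point (d : ppoint k n) : grmod R_alg := gr_restr R_incl (tw_point psi d).
End GeneratedAlgebra.

(* A family of point modules with point ideals J(e), e in P^m, is algebraic when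
   each e |-> J(e)_n is a morphism from P^m to the projective space of
   hyperplanes of A_n: near each e0, J(e)_n is the kernel of a nonzero linear form
   on A_n whose coefficients are homogeneous polynomials in e of the same degree. *)
Definition algebraic_family (k : fieldType) (A : gralg k) (m : nat)
    (F : ppoint k m -> grmod A) : Prop :=
  forall (n : nat) (e0 : ppoint k m), exists (D : nat) (L : {linear A -> {mpoly k[m.+1]}}),
    [/\ forall a, a \in gcomp (ga_gr A) n -> L a \is D.-homog,
        exists2 a, a \in gcomp (ga_gr A) n & ~ vanishes (L a) e0 &
        forall e, (exists2 a, a \in gcomp (ga_gr A) n & ~ vanishes (L a) e) ->
          forall a, a \in gcomp (ga_gr A) n ->
            (point_ideal (F e) a <-> vanishes (L a) e)].

(* Main.v *)
Require Import Defs.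
From HB Require Import structures.
From mathcomp Require Import all_boot all_order all_algebra.
From mathcomp Require Import generic_quotient ring_quotient boolp mpoly.
From mathcomp Require Import ring zify.

(** Write c_l for phi^(-l)(c) and L_l for the space of linear forms vanishing at c_l.  A
    product in S is a commutative product of psi-translates, so R_n is spanned by the
    products g_0 ... g_(n-1) with g_l in L_l.  Let M be a point module over R with
    homogeneous basis x_0, x_1, and so on.  An element of (m_c)_1, read through psi^n as a
    form g in L_n, sends x_n to a multiple of x_(n+1), and the factor is a nonzero linear
    functional of g; such a functional is evaluation at a vector p_n that is not
    proportional to c_n.  Since R is generated in degree one, the functionals g |-> g(p_n)
    on L_n, up to scalars, determine M: this is the dictionary formed by
    point_data_exists, point_data_iso and iso_point_data.  In these terms P(d) has p_n = d
    for all n, and P(c_i, e) has p_n = c_i for n distinct from i while p_i is a tangent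
    direction at c_i.

    These sequences are the only ones because a tensor in L_0, ..., L_(n-1) whose product
    vanishes in U is zero in R and hence acts by zero (action_relation3).  Commutativity in
    two slots shows that the lines joining c_i to p_i and c_j to p_j meet; their
    intersection is given by an explicit vector d.  Commutativity in three slots shows that
    d and p_l have the same projection from c_l for every l, unless d = c_l (common_point).
    If d is none of the c_l with l >= 0 then M is P(d).  If d = c_i then p_l is c_i
    for l different from i and p_i is arbitrary, so M is P(c_i, e) for some e.

    Critical density enters through two facts: the points c_l with l >= 0 are distinct, and
    no hyperplane contains them all (critical_density_orbit).  The second one provides two
    distinct lines to intersect, and shows that two different points have different
    projections from some c_l (points_separated), which separates the isomorphism classes.

    The point ideal of P(c_i, e) is explicit: an element of degree n is evaluated at c_i
    when n <= i, and is differentiated at c_i in the direction e when n > i.  This is a left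
    ideal by the Leibniz rule, because every element of R_n with n > i vanishes at c_i.  The
    derivatives at c_i of the elements of the square of m_(c_i) vanish, and conversely a
    point module killed by products containing two factors that vanish at c_i has p_l = c_i
    for every l distinct from i. *)

Set Implicit Arguments.
Unset Strict Implicit.
Unset Printing Implicit Defensive.

Import Order.TTheory GRing.Theory Num.Theory.
Local Open Scope ring_scope.
Local Open Scope quotient_scope.
Local Notation form f := (f \is (1%N).-homog).

(** * Graded modules *)

Section GradedModules.
Variables (k : fieldType) (A : gralg k).
Implicit Types (M N : grmod A) (n : int).

Lemma scalar_homog M n (s : k) (z : M) : z \in hcomp M n -> s%:A *: z \in hcomp M n.
Proof. by move=> zn; rewrite -[n]add0r; apply: gm_act zn; apply: ga_scalar. Qed.

Lemma scalarM (s s' : k) M (z : M) : s%:A *: (s'%:A *: z) = (s * s')%:A *: z.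
Proof. by rewrite scalerA -scalerAl mul1r scalerA. Qed.

Lemma scalar_act (s : k) (a : A) M (z : M) : a *: (s%:A *: z) = s%:A *: (a *: z).
Proof. by rewrite !scalerA -scalerAr -scalerAl mulr1 mul1r. Qed.

Lemma scalar1 M (z : M) : (1 : k)%:A *: z = z.
Proof. by rewrite scale1r scale1r. Qed.

Lemma scalar_eq0 (s : k) M (z : M) : s%:A *: z = 0 <-> s = 0 \/ z = 0.
Proof.
split=> [|[->|->]]; rewrite ?scale0r ?scaler0 //.
have [->|s0] := eqVneq s 0; first by left.
move/(congr1 (fun z => s^-1%:A *: z)); rewrite scaler0 scalarM mulVf // scalar1.
by right.
Qed.

Lemma scalar_inj (s s' : k) M (z : M) : z != 0 -> s%:A *: z = s'%:A *: z -> s = s'.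
Proof.
move=> /eqP z0 /eqP; rewrite -subr_eq0 -scalerBl -scalerBl => /eqP/scalar_eq0.
by case=> // /eqP; rewrite subr_eq0 => /eqP.
Qed.

Lemma gproj_act M n (j : nat) (a : A) (z : M) : z \in hcomp M n ->
  gm_gr M (j%:Z + n) (a *: z) = ga_gr A j a *: z.
Proof.
move=> zn; have [s us Ea] := gproj_sum (ga_gr A) a.
have Hp i : gm_gr M (j%:Z + n) (ga_gr A i a *: z) = if i == j then ga_gr A i a *: z else 0.
  have Hi : ga_gr A i a *: z \in gcomp (gm_gr M) (i%:Z + n).
    by apply: gm_act zn; apply: gproj_in.
  case: eqP => [<-|/eqP ij]; first exact/gcompP.
  apply: (gproj_neq Hi); apply: contra ij => /eqP /addIr [->] //.
rewrite {1}Ea scaler_suml gproj_bigsum (eq_bigr _ (fun i _ => Hp i)) -big_mkcond /=.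
rewrite [in RHS]Ea gproj_bigsum scaler_suml big_mkcond; apply: eq_bigr => i _.
by rewrite gproj_orth (eq_sym j); case: eqP => // _; rewrite scale0r.
Qed.

Lemma act_homog_eq0 M n (a : A) (z : M) : z \in hcomp M n ->
  (a *: z = 0) <-> (forall j, ga_gr A j a *: z = 0).
Proof.
move=> zn; split=> [az j|H]; first by rewrite -(gproj_act j a zn) az gproj0.
by have [s _ ->] := gproj_sum (ga_gr A) a; rewrite scaler_suml big1.
Qed.

Section CyclicIso.
Variables (M N : grmod A) (n : int) (x : M) (y : N).
Hypotheses (xn : x \in hcomp M n) (yn : y \in hcomp N n).
Hypotheses (xgen : forall z, exists a : A, z = a *: x).
Hypotheses (ygen : forall z, exists a : A, z = a *: y).
Hypothesis ann : forall a : A, a *: x = 0 <-> a *: y = 0.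

(** Both modules are the quotient of A by the same annihilator; the map sends a x to a y. *)
Lemma cyclic_iso : gr_iso M N.
Proof.
have [g Hg] := choice xgen; have [h Hh] := choice ygen.
have ann2 a b : a *: x = b *: x <-> a *: y = b *: y.
  split=> /eqP; rewrite -subr_eq0 -scalerBl => /eqP/ann/eqP; rewrite scalerBl subr_eq0.
    by move/eqP.
  by move/eqP.
have fE a : g (a *: x) *: y = a *: y by apply/ann2; rewrite -Hg.
pose f z := g z *: y.
have flin : linear f.
  move=> a u v; rewrite /f (Hg u) (Hg v) scalerA -scalerDl !fE.
  by rewrite scalerDl scalerA.
pose F : {linear M -> N} := HB.pack f (GRing.isLinear.Build A M N *:%R f flin).
exists F; split.
  exists (fun z => h z *: x) => z /=.
    by rewrite /f [in RHS](Hg z); apply/ann2; rewrite -Hh.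
  by rewrite /f fE -Hh.
move=> j z zj; rewrite /= /f.
have /gcompP Ez := zj.
have [jn|nj] := ltP j n.
  have -> : z = 0.
    rewrite -Ez (Hg z); apply: (act_low _ _ jn) => l ln.
    by apply: (gproj_neq xn); apply: contraTneq ln => ->; rewrite ltxx.
  by rewrite -(scale0r x) fE scale0r; apply: gcomp0.
have [m Em] : exists m : nat, j = m%:Z + n.
  by exists `|j - n|%N; lia.
have {1}-> : z = ga_gr A m (g z) *: x by rewrite -(gproj_act _ _ xn) -Hg -Em Ez.
rewrite fE Em; apply: gm_act yn; exact: gproj_in.
Qed.
End CyclicIso.

Lemma gr_iso_sym M N : gr_iso M N -> gr_iso N M.
Proof.
move=> [f [fb fh]]; have [g gf fg] := fb.
have glin : linear g by move=> a u v; apply: (can_inj gf); rewrite fg linearP !fg.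
pose G : {linear N -> M} := HB.pack g (GRing.isLinear.Build A N M *:%R g glin).
exists G; split; first by exists f.
move=> n x xn /=; apply/gcompP; apply: (can_inj gf); rewrite fg.
have fE z j : f (gm_gr M j z) = gm_gr N j (f z).
  have [s us Ez] := gproj_sum (gm_gr M) z; rewrite {2}Ez raddf_sum gproj_bigsum.
  rewrite {1}Ez gproj_bigsum raddf_sum; apply: eq_bigr => i _.
  have Hi : f (gm_gr M i z) \in hcomp N i by apply/fh/gproj_in.
  rewrite gproj_orth; case: eqP => [->|/eqP ji]; first by rewrite (gcompP _ _ _ Hi).
  by rewrite raddf0 (gproj_neq Hi).
by rewrite fE fg; apply/gcompP.
Qed.

End GradedModules.

(** * Algebras generated in degree one *)

Section GeneratedInDegreeOne.
Variables (k : fieldType) (A : gralg k) (V : A -> Prop).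
Hypothesis V1 : forall a, V a -> a \in gcomp (ga_gr A) 1%N.
Hypothesis genV : forall a, gen_subalg V a.

(** Induction on words in the generators, for predicates on homogeneous elements that may
    depend on the degree. *)
Lemma homog_ind (P : nat -> A -> Prop) :
  (forall m, P m 0) -> (forall m a b, P m a -> P m b -> P m (a + b)) ->
  (forall s : k, P 0%N s%:A) -> (forall a, V a -> P 1%N a) ->
  (forall i j a b, a \in gcomp (ga_gr A) i -> b \in gcomp (ga_gr A) j ->
     P i a -> P j b -> P (i + j)%N (a * b)) ->
  forall m a, a \in gcomp (ga_gr A) m -> P m a.
Proof.
move=> P0 PD Ps PV PM m a /gcompP <-.
have Pc i b : b \in gcomp (ga_gr A) i -> P i b -> forall j, P j (ga_gr A j b).
  move=> bi Pb j; have [<-|/eqP ij] := i =P j; first by rewrite (gcompP _ _ _ bi).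
  by rewrite (gproj_neq bi) // 1?eq_sym.
elim: (genV a) m => {a} [a Va|s|a b _ IHa _ IHb|a b _ IHa _ IHb] m.
- exact: Pc (V1 Va) (PV _ Va) m.
- exact: Pc (ga_scalar A s) (Ps s) m.
- by rewrite gprojD; apply: PD.
have Psum (J : eqType) (s : seq J) F : (forall j, P m (F j)) -> P m (\sum_(j <- s) F j).
  by move=> HF; apply: big_ind => [|u v|j _]; [apply: P0 | apply: PD | apply: HF].
have [s _ ->] := gproj_sum (ga_gr A) a; have [s' _ ->] := gproj_sum (ga_gr A) b.
rewrite mulr_suml gproj_bigsum; apply: (Psum) => i.
rewrite mulr_sumr gproj_bigsum; apply: (Psum) => j.
apply: (Pc (i + j)%N); first by apply: ga_mul; apply: gproj_in.
by apply: PM; rewrite ?gproj_in.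
Qed.

Section ChainIso.
Variables (M N : grmod A) (n0 : int) (x : nat -> M) (y : nat -> N).
Hypothesis xn : forall n, x n \in hcomp M (n%:Z + n0).
Hypothesis yn : forall n, y n \in hcomp N (n%:Z + n0).
Hypothesis xgen : forall z, exists a : A, z = a *: x 0%N.
Hypothesis ygen : forall z, exists a : A, z = a *: y 0%N.
Hypothesis xy0 : forall n, x n = 0 <-> y n = 0.
Hypothesis xyV : forall n a, V a ->
  exists s : k, a *: x n = s%:A *: x n.+1 /\ a *: y n = s%:A *: y n.+1.

(** If the generators move along x and along y with the same coefficients, then so do all
    homogeneous elements, and x 0 and y 0 have the same annihilator.  The terms of the two
    sequences are allowed to vanish, so that truncations are covered. *)
Lemma chain_iso : gr_iso M N.
Proof.
have H : forall m a, a \in gcomp (ga_gr A) m -> forall n,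
    exists s : k, a *: x n = s%:A *: x (m + n)%N /\ a *: y n = s%:A *: y (m + n)%N.
  apply: homog_ind => [m n|m a b Pa Pb n|s n|a Va n|i j a b ai bj Pa Pb n].
  - by exists 0; rewrite !scale0r.
  - have [s [Ea Ea']] := Pa n; have [s' [Eb Eb']] := Pb n.
    exists (s + s').
    by rewrite !scalerDl Ea Ea' Eb Eb'.
  - by exists s.
  - exact: xyV.
  have [s [Ex Ey]] := Pb n; have [s' [Ex' Ey']] := Pa (j + n)%N.
  exists (s * s'); rewrite -[(a * b) *: x n]scalerA -[(a * b) *: y n]scalerA -addnA.
  by rewrite Ex Ey !scalar_act Ex' Ey' !scalarM.
apply: (@cyclic_iso _ _ _ _ (0%:Z + n0) (x 0%N) (y 0%N)) => // a.
rewrite (act_homog_eq0 _ (xn 0)) (act_homog_eq0 _ (yn 0)).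
split=> Ha j; have [s [Ex Ey]] := H j _ (gproj_in (ga_gr A) j a) 0%N;
  move/(_ j): Ha; rewrite Ex Ey !scalar_eq0 xy0 //.
Qed.
End ChainIso.

End GeneratedInDegreeOne.

(** * Homogeneous bases and truncations *)

Section Bases.
Variables (k : fieldType) (A : gralg k).
Implicit Types (M N : grmod A).

(** The vectors x n may vanish, as happens for truncations. *)
Record homog_basis M (n0 : int) (x : nat -> M) : Prop := HomogBasis {
  hb_mem : forall n, x n \in hcomp M (n%:Z + n0);
  hb_low : forall j z, z \in hcomp M j -> j < n0 -> z = 0;
  hb_span : forall n z, z \in hcomp M (n%:Z + n0) -> exists s : k, z = s%:A *: x n
}.

Section OneBasis.
Variables (M : grmod A) (n0 : int) (x : nat -> M).
Hypothesis bx : homog_basis n0 x.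

Lemma hb_cyclic : (forall n, exists a : A, x n.+1 = a *: x n) ->
  forall z, exists a : A, z = a *: x 0%N.
Proof.
move=> step z; have gen n : exists a : A, x n = a *: x 0%N.
  elim: n => [|n [a Ea]]; first by exists 1; rewrite scale1r.
  by have [b Eb] := step n; exists (b * a); rewrite -scalerA -Ea.
have hgen j u : u \in hcomp M j -> exists a : A, u = a *: x 0%N.
  move=> uj; have [jn|nj] := ltP j n0.
    by exists 0; rewrite (hb_low bx uj jn) scale0r.
  have [m Em] : exists m : nat, j = m%:Z + n0 by exists `|j - n0|%N; lia.
  rewrite Em in uj; have [s ->] := hb_span bx uj; have [a ->] := gen m.
  by exists (s%:A * a); rewrite scalerA.
have [s _ ->] := gproj_sum (gm_gr M) z.
elim: s => [|j s [a Ea]]; first by exists 0; rewrite big_nil scale0r.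
have [b Eb] := hgen _ _ (gproj_in (gm_gr M) j z).
by exists (b + a); rewrite big_cons Ea scalerDl -Eb.
Qed.

Lemma hb_act m n (a : A) : a \in gcomp (ga_gr A) m ->
  exists s : k, a *: x n = s%:A *: x (m + n)%N.
Proof.
move=> am; apply: (hb_span bx); rewrite PoszD -addrA; apply: gm_act am _.
exact: hb_mem.
Qed.
End OneBasis.

(** Negative degrees vanish because M is generated in degree 0 and A is nonnegatively
    graded; any basis vector of M_0 can serve as the generator. *)
Lemma point_moduleP M : is_point_module M <->
  exists x : nat -> M,
    [/\ homog_basis 0 x, forall n, x n != 0 & forall z, exists a : A, z = a *: x 0%N].
Proof.
split=> [[[g g0 ggen] M1]|[x [bx x0 xgen]]].
  have /choice [x Hx] : forall n : nat, exists x : M, x \in hcomp M n /\ (x != 0 /\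
      forall y, y \in hcomp M n -> exists s : k, y = s%:A *: x).
    by move=> n; have [x xn Hx] := M1 n; exists x.
  have xgen z : exists a : A, z = a *: x 0%N.
    have [a ->] := ggen z; have [_ [_ Hg]] := Hx 0%N; have [s ->] := Hg g g0.
    by exists (a * s%:A); rewrite scalerA.
  exists x; split=> //; last by move=> n; case: (Hx n) => _ [].
  split=> [n|j z zj j0|n z]; first by rewrite addr0; case: (Hx n).
    rewrite -(gcompP _ _ _ zj); have [a ->] := xgen z.
    apply: (act_low _ _ j0) => l l0; case: (Hx 0%N) => x0 _.
    by apply: (gproj_neq x0); apply: contraTneq l0 => ->.
  by rewrite addr0; case: (Hx n) => _ [_]; apply.
split.
  by exists (x 0%N) => //; have := hb_mem bx 0; rewrite addr0.
move=> n; exists (x n); first by have := hb_mem bx n; rewrite addr0.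
by split=> // y yn; apply: (hb_span bx); rewrite addr0.
Qed.

Lemma point_ideal_basis M x (a : A) : @homog_basis M 0 x -> point_ideal M a <-> a *: x 0%N = 0.
Proof.
move=> bx; split=> [|ax z z0]; first by apply; have := hb_mem bx 0; rewrite addr0.
have [|s ->] := hb_span bx (n := 0) (z := z); first by rewrite addr0.
by rewrite scalar_act ax scaler0.
Qed.

Lemma point_ideal_iso M N (a : A) : gr_iso M N -> point_ideal M a -> point_ideal N a.
Proof.
move=> /gr_iso_sym [f [[g gf fg] fh]] Ha x x0; apply: (can_inj gf).
by rewrite linearZ raddf0; apply/Ha/fh.
Qed.

Section Truncation.
Variables (M : grmod A) (x : nat -> M).
Hypotheses (bx : homog_basis 0 x) (x0 : forall n, x n != 0).

Lemma hb_ge_mem n (n0 : nat) : x (n + n0)%N \in gs_mem (gr_ge_sub M n0).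
Proof.
apply/asboolP => j jn; apply: (gproj_neq (hb_mem bx (n + n0))).
by apply: contraTneq jn => ->; rewrite addr0 -leNgt lez_nat leq_addl.
Qed.

Definition ge_basis (n0 : nat) (n : nat) : gr_ge M n0 := SubM (hb_ge_mem n n0).

Lemma hb_ge (n0 : nat) : homog_basis n0 (ge_basis n0).
Proof.
split=> [n|j z /gcompP zj jn|n z /gcompP zj].
- apply/gcompP/val_inj; apply/gcompP; have := hb_mem bx (n + n0).
  by rewrite addr0 PoszD.
- rewrite -zj; apply: val_inj => /=.
  by have /asboolP := subm_mem z; apply.
have zj' : val z \in hcomp M (n + n0)%N by rewrite -zj; apply: gproj_in.
have [|s Es] := hb_span bx (n := (n + n0)%N) (z := val z); first by rewrite addr0.
by exists s; apply: val_inj.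
Qed.

Definition le_basis (i : nat) (n : nat) : gr_le M i := \pi_(quotm (gr_ge_sub M (i%:Z + 1))) (x n).

Lemma hb_le i : homog_basis 0 (le_basis i).
Proof.
split=> [n|j z /gcompP zj jn|n z /gcompP zj].
- apply/gcompP; rewrite /= /le_basis quotm_proj_pi; congr (\pi_ _ _).
  exact/gcompP/(hb_mem bx).
- rewrite -zj; case: (quotm_surj z) => u ->; rewrite /= quotm_proj_pi.
  by rewrite (hb_low bx (gproj_in _ _ _) jn) quotm_pi0.
rewrite -zj; case: (quotm_surj z) => u ->; rewrite /= quotm_proj_pi.
have [s ->] := hb_span bx (gproj_in (gm_gr M) (n%:Z + 0) u); exists s.
by rewrite -quotm_pi_scale.
Qed.

Lemma le_basis_eq0 i n : le_basis i n = 0 <-> (i < n)%N.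
Proof.
have -> : (0 : gr_le M i) = \pi_(quotm (gr_ge_sub M (i%:Z + 1))) 0 by rewrite quotm_pi0.
rewrite quotm_pi subr0; split=> [/asboolP H|iN].
  rewrite ltnNge; apply: contra (x0 n) => ni; apply/eqP.
  rewrite -(gcompP _ _ _ (hb_mem bx n)); apply: H; lia.
apply/asboolP => j jn; apply: (gproj_neq (hb_mem bx n)).
by apply: contraTneq jn => ->; rewrite -leNgt; lia.
Qed.
End Truncation.

End Bases.

Section IsoOfBases.
Variables (k : fieldType) (A : gralg k) (V : A -> Prop).
Hypothesis V1 : forall a, V a -> a \in gcomp (ga_gr A) 1%N.
Hypothesis genV : forall a, gen_subalg V a.

(** If the generators killed x n, no word could cross from degree n to degree n + 1, and
    x n.+1 would not be reached from x 0. *)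
Lemma generator_nonzero (M : grmod A) n0 (x : nat -> M) n :
  homog_basis n0 x -> (forall z, exists a : A, z = a *: x 0%N) -> x n.+1 != 0 ->
  exists2 a, V a & a *: x n != 0.
Proof.
move=> bx xgen xn0; apply: contrapT => noV.
have kill a : V a -> a *: x n = 0.
  by move=> Va; apply/eqP; apply: contrapT => /negP ax; apply: noV; exists a.
have H : forall m a, a \in gcomp (ga_gr A) m ->
    forall j, (j <= n)%N -> (n < m + j)%N -> a *: x j = 0.
  apply: (homog_ind V1 genV) => [m j|m a b Pa Pb j jn nj|s j|a Va j jn nj|].
  - by rewrite scale0r.
  - by rewrite scalerDl Pa // Pb // addr0.
  - lia.
  - by have -> : j = n; [lia | apply: kill].
  move=> i l a b ai bl Pa Pb j jn nj; rewrite -scalerA.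
  have [nl|ln] := ltnP n (l + j); first by rewrite Pb // scaler0.
  have [s ->] := hb_act bx j bl; rewrite scalar_act Pa ?scaler0 //; lia.
have [a Ea] := xgen (x n.+1).
have E : x n.+1 = ga_gr A n.+1 a *: x 0%N.
  have Hm := hb_mem bx 0; rewrite -(gproj_act _ _ Hm) -Ea; apply/esym/gcompP.
  by have := hb_mem bx n.+1; rewrite add0r.
by move/eqP: xn0; apply; rewrite E (H n.+1) ?gproj_in // addn0.
Qed.

Section Two.
Variables (M N : grmod A) (x : nat -> M) (y : nat -> N).
Hypotheses (bx : homog_basis 0 x) (x0 : forall n, x n != 0).
Hypotheses (hby : homog_basis 0 y) (y0 : forall n, y n != 0).

Definition same_action (P : pred nat) : Prop :=
  forall n, P n ->
    (forall a, V a -> exists s : k, a *: x n = s%:A *: x n.+1 /\ a *: y n = s%:A *: y n.+1)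
    /\ exists2 a, V a & a *: x n != 0.

Lemma same_action_step P n : same_action P -> P n ->
  (exists a : A, x n.+1 = a *: x n) /\ (exists a : A, y n.+1 = a *: y n).
Proof.
move=> H /H [HV [a Va ax]]; have [s [Ex Ey]] := HV a Va.
have s0 : s != 0 by apply: contraNneq ax => s0; rewrite Ex s0 !scale0r.
by split; exists (s^-1%:A * a); rewrite -scalerA ?Ex ?Ey scalarM mulVf // scalar1.
Qed.

Lemma iso_of_same_action : same_action predT -> gr_iso M N.
Proof.
move=> H; have step n := same_action_step H (isT : predT n).
apply: (chain_iso V1 genV (hb_mem bx) (hb_mem hby)).
- by apply: (hb_cyclic bx) => n; case: (step n).
- by apply: (hb_cyclic hby) => n; case: (step n).
- by move=> n; split=> /eqP; rewrite ?(negPf (x0 n)) ?(negPf (y0 n)).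
by move=> n a Va; case: (H n isT) => + _; apply.
Qed.

Lemma iso_ge n0 : same_action (fun n => n0 <= n)%N -> gr_iso (gr_ge M n0) (gr_ge N n0).
Proof.
move=> H; have step n := same_action_step H (leq_addl n n0).
apply: (chain_iso V1 genV (hb_mem (hb_ge bx n0)) (hb_mem (hb_ge hby n0))).
- apply: (hb_cyclic (hb_ge bx n0)) => n; have [[a Ea] _] := step n.
  by exists a; apply: val_inj.
- apply: (hb_cyclic (hb_ge hby n0)) => n; have [_ [a Ea]] := step n.
  by exists a; apply: val_inj.
- move=> n; split=> /(congr1 val) /eqP /=.
    by rewrite (negPf (x0 _)).
  by rewrite (negPf (y0 _)).
move=> n a Va; have [+ _] := H _ (leq_addl n n0) => /(_ a Va) [s [Ex Ey]].
by exists s; split; apply: val_inj.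
Qed.

(** Only the steps below i matter: the step from i to i + 1 is zero in both truncations. *)
Lemma iso_le i : same_action (fun n => n < i)%N -> gr_iso (gr_le M i) (gr_le N i).
Proof.
move=> H; apply: (chain_iso V1 genV (hb_mem (hb_le bx i)) (hb_mem (hb_le hby i))).
- apply: (hb_cyclic (hb_le bx i)) => n; have [ni|iN] := ltnP n i.
    have [[a Ea] _] := same_action_step H ni.
    by exists a; rewrite /le_basis Ea -quotm_pi_scale.
  by exists 0; rewrite scale0r; apply/le_basis_eq0.
- apply: (hb_cyclic (hb_le hby i)) => n; have [ni|iN] := ltnP n i.
    have [_ [a Ea]] := same_action_step H ni.
    by exists a; rewrite /le_basis Ea -quotm_pi_scale.
  by exists 0; rewrite scale0r; apply/le_basis_eq0.
- by move=> n; rewrite !le_basis_eq0.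
move=> n a Va; have Ex : a *: le_basis x i n = \pi_(quotm (gr_ge_sub M (i%:Z + 1))) (a *: x n).
  exact: quotm_pi_scale.
have Ey : a *: le_basis y i n = \pi_(quotm (gr_ge_sub N (i%:Z + 1))) (a *: y n).
  exact: quotm_pi_scale.
have [ni|iN] := ltnP n i.
  have [+ _] := H _ ni => /(_ a Va) [s [Ex' Ey']].
  by exists s; rewrite Ex Ey Ex' Ey' /le_basis -!quotm_pi_scale.
exists 0; rewrite !scale0r Ex Ey.
have am := V1 Va.
have [s ->] := hb_act bx n am; have [s' ->] := hb_act hby n am.
have Zx : le_basis x i (1 + n) = 0 by apply/le_basis_eq0.
have Zy : le_basis y i (1 + n) = 0 by apply/le_basis_eq0.
rewrite -!quotm_pi_scale; split.
  by rewrite -[X in quotm_scale _ X]/(le_basis x i (1 + n)) Zx; apply: (scaler0 (_ : lmodType _)).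
by rewrite -[X in quotm_scale _ X]/(le_basis y i (1 + n)) Zy; apply: (scaler0 (_ : lmodType _)).
Qed.
End Two.
End IsoOfBases.

(** * Linear forms, derivatives and points of projective space *)

Section LinearForms.
Variables (k : fieldType) (n : nat).
Implicit Types (f g : {mpoly k[n]}) (v w : 'rV[k]_n).

Lemma form_sum f : form f -> f = \sum_i f@_U_(i) *: 'X_i.
Proof.
move=> f1; apply/mpolyP => m; rewrite raddf_sum /=.
have [/mdeg1P [j /eqP ->]|m1] := boolP (mdeg m == 1%N).
  rewrite (bigD1 j) //= mcoeffZ mcoeffXU eqxx mulr1 big1 ?addr0 // => i ij.
  by rewrite mcoeffZ mcoeffXU (negPf ij) mulr0.
rewrite (dhomog_nemf_coeff f1 m1) big1 // => i _.
rewrite mcoeffZ mcoeffX; case: eqP => [E|_]; last by rewrite mulr0.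
by case/negP: m1; rewrite -E; apply/mdeg1P; exists i.
Qed.

Lemma form_ev f v : form f -> f.@[v 0] = \sum_i f@_U_(i) * v 0 i.
Proof.
move=> /form_sum {1}->; rewrite raddf_sum /=; apply: eq_bigr => i _.
by rewrite mevalZ mevalXU.
Qed.

Lemma form_evD f (s : k) v w : form f ->
  f.@[(s *: v + w) 0] = s * f.@[v 0] + f.@[w 0].
Proof.
move=> f1; rewrite !form_ev // mulr_sumr -big_split; apply: eq_bigr => i _ /=.
by rewrite !mxE; ring.
Qed.

Lemma form_evZ f (s : k) v : form f -> f.@[(s *: v) 0] = s * f.@[v 0].
Proof.
move=> f1; rewrite !form_ev // mulr_sumr; apply: eq_bigr => i _ /=.
by rewrite !mxE; ring.
Qed.

Lemma form_X (i : 'I_n) : form ('X_i : {mpoly k[n]}).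
Proof. by rewrite dhomogX; apply/eqP; apply: mdeg1. Qed.

Lemma homog_evZ e f (s : k) v : f \is e.-homog -> f.@[(s *: v) 0] = s ^+ e * f.@[v 0].
Proof.
move=> /dhomogP fe; rewrite !mevalE mulr_sumr big_seq [RHS]big_seq.
apply: eq_bigr => m /fe em; have <- : mdeg m = e by exact: em.
rewrite mulrCA; congr (_ * _).
rewrite mdegE -prodrXr -big_split /=.
by apply: eq_bigr => i _; rewrite mxE exprMn.
Qed.

Lemma form_sub (s : k) f g : form f -> form g -> form (f - s *: g).
Proof. by move=> f1 g1; rewrite -scaleNr rpredD // rpredZ. Qed.

Definition kills v f : Prop := form f /\ f.@[v 0] = 0.

Lemma kills_opp v f : kills v f -> kills v (- f).
Proof. by case=> f1 fv; split; [rewrite -scaleN1r rpredZ | rewrite mevalN fv oppr0]. Qed.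

(** Subtracting a multiple of a form that is nonzero at v is the standard way of making
    a form vanish at v without changing its values at the zeros of the other one. *)
Lemma kills_elim v f g : form f -> form g -> g.@[v 0] != 0 ->
  kills v (f - (f.@[v 0] / g.@[v 0]) *: g).
Proof.
move=> f1 g1 gv; split; first exact: form_sub.
by rewrite mevalB mevalZ divfK // subrr.
Qed.

(** As i varies these span the forms vanishing at v, provided that v_j is nonzero. *)
Definition elim_form v (j i : 'I_n) : {mpoly k[n]} := 'X_i - (v 0 i / v 0 j) *: 'X_j.

Lemma elim_form1 v j i : form (elim_form v j i).
Proof. by apply: form_sub; apply: form_X. Qed.

Lemma elim_form_ev v j i w :
  (elim_form v j i).@[w 0] = w 0 i - (v 0 i / v 0 j) * w 0 j.
Proof. by rewrite mevalB mevalZ !mevalXU. Qed.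

Lemma nonzero_coord v : v != 0 -> exists j, v 0 j != 0.
Proof.
move=> v0; apply: contrapT => H; move/eqP: v0; apply; apply/rowP => j; rewrite mxE.
by apply/eqP; apply: contrapT => /negP vj; apply: H; exists j.
Qed.

Lemma colinear_of_forms v w : w != 0 ->
  (forall f, form f -> f.@[w 0] = 0 -> f.@[v 0] = 0) -> exists s, v = s *: w.
Proof.
move=> /nonzero_coord [j wj] H; exists (v 0 j / w 0 j); apply/rowP => i; rewrite mxE.
have := H _ (elim_form1 w j i); rewrite !elim_form_ev divfK // subrr => /(_ erefl)/eqP.
by rewrite subr_eq0 => /eqP ->; field.
Qed.

Lemma separating_form v w : w != 0 -> (forall s, v <> s *: w) ->
  exists f, [/\ form f, f.@[w 0] = 0 & f.@[v 0] = 1].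
Proof.
move=> w0 vw; apply: contrapT => H.
have [|s] := @colinear_of_forms v w w0; last exact: vw.
move=> f f1 fw; apply/eqP; apply: contrapT => /negP fv; apply: H.
exists (f.@[v 0]^-1 *: f); split; first exact: rpredZ.
  by rewrite mevalZ fw mulr0.
by rewrite mevalZ mulVf.
Qed.

(** The forms vanishing at v are the dual of the quotient of k^n by the line of v, so p is
    determined modulo v. *)
Lemma functional_as_point v (mu : {mpoly k[n]} -> k) : v != 0 ->
  (forall s f g, kills v f -> kills v g -> mu (s *: f + g) = s * mu f + mu g) ->
  exists p : 'rV[k]_n, forall f, kills v f -> mu f = f.@[p 0].
Proof.
move=> /nonzero_coord [j vj] mulin.
have K0 : kills v 0 by split; [apply: dhomog0 | apply: meval0].
have mu0 : mu 0 = 0.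
  by apply/(addrI (mu 0)); rewrite addr0 -{1}[mu 0]mul1r -mulin // scale1r addr0.
have Ke i : kills v (elim_form v j i).
  by split; [apply: elim_form1 | rewrite elim_form_ev divfK // subrr].
exists (\row_i mu (elim_form v j i)) => f [f1 fv].
have Ef : f = \sum_i f@_U_(i) *: elim_form v j i.
  under eq_bigr => i _ do rewrite scalerBr scalerA mulrA.
  rewrite sumrB -form_sum // -scaler_suml -mulr_suml.
  by rewrite -form_ev // fv mul0r scale0r subr0.
rewrite form_ev // {1}Ef.
have : kills v (\sum_i f@_U_(i) *: elim_form v j i) /\
    mu (\sum_i f@_U_(i) *: elim_form v j i) = \sum_i f@_U_(i) * mu (elim_form v j i).
  elim/big_ind2: _ => [|s g s' h [Kg Eg] [Kh Eh]|i _].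
  - by [].
  - case: (Kg) (Kh) => [g1 gv] [h1 hv]; split.
      by split; [apply: rpredD | rewrite mevalD gv hv addr0].
    by have := mulin 1 g h Kg Kh; rewrite scale1r mul1r Eg Eh.
  - case: (Ke i) => e1 ev; split; first by split; [apply: rpredZ | rewrite mevalZ ev mulr0].
    by have := mulin f@_U_(i) _ 0 (Ke i) K0; rewrite mu0 !addr0.
by case=> _ ->; apply: eq_bigr => i _; rewrite mxE.
Qed.

Definition dir_deriv f w v : k := \sum_i w 0 i * (f^`M(i)).@[v 0].

Lemma dir_derivP (s : k) f g w v : dir_deriv (s *: f + g) w v = s * dir_deriv f w v + dir_deriv g w v.
Proof.
rewrite /dir_deriv mulr_sumr -big_split; apply: eq_bigr => i _ /=.
by rewrite mderivD mderivZ mevalD mevalZ; ring.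
Qed.

Lemma dir_derivDr (s : k) f w w' v : dir_deriv f (s *: w + w') v = s * dir_deriv f w v + dir_deriv f w' v.
Proof.
rewrite /dir_deriv mulr_sumr -big_split; apply: eq_bigr => i _ /=.
by rewrite !mxE; ring.
Qed.

Lemma dir_derivM f g w v : dir_deriv (f * g) w v = dir_deriv f w v * g.@[v 0] + f.@[v 0] * dir_deriv g w v.
Proof.
rewrite /dir_deriv mulr_suml mulr_sumr -big_split; apply: eq_bigr => i _ /=.
by rewrite mderivM mevalD !mevalM; ring.
Qed.

Lemma dir_deriv_form f w v : form f -> dir_deriv f w v = f.@[w 0].
Proof.
move=> f1; rewrite form_ev //; apply: eq_bigr => i _; rewrite mulrC; congr (_ * _).
rewrite [in LHS](form_sum f1) (big_morph _ (mderivD i) (mderiv0 _ i)) raddf_sum /=.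
rewrite (bigD1 i) //= big1 ?addr0.
  rewrite mderivZ mderivX mevalZ mnm1E eqxx scale1r.
  have -> : (U_(i) - U_(i) = 0 :> 'X_{1..n})%MM by apply/mnmP => l; rewrite !mnmE subnn.
  by rewrite mpolyX0 meval1 mulr1.
move=> l li; rewrite mderivZ mderivX mevalZ mnm1E (negPf li) scale0r meval0 mulr0 //.
Qed.

Lemma pihomogM m f g : pihomog mdeg m (f * g) =
  \sum_(i < msize f) \sum_(j < msize g)
    if (i + j)%N == m then pihomog mdeg i f * pihomog mdeg j g else 0.
Proof.
rewrite [in LHS](homog_parts f) [in LHS](homog_parts g) mulr_suml raddf_sum /=.
apply: eq_bigr => i _; rewrite mulr_sumr raddf_sum /=; apply: eq_bigr => j _.
have H := dhomogM (pihomogP mdeg i f) (pihomogP mdeg j g).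
case: eqP => [<-|/eqP ij]; first (by rewrite (pihomog_dE H)).
by rewrite (pihomog_ne0 ij H).
Qed.

End LinearForms.

(** This is where the projective space must have dimension at least two. *)
Lemma form_through_two_points (k : fieldType) (n : nat) (v w : 'rV[k]_n) : (2 < n)%N ->
  exists f : {mpoly k[n]}, [/\ f != 0, form f, f.@[v 0] = 0 & f.@[w 0] = 0].
Proof.
move=> n2; pose A := (col_mx v w)^T.
have : kermx A != 0.
  rewrite kermx_eq0; apply/negP => /eqP rA.
  by have := rank_leq_col A; rewrite rA; apply/negP; rewrite -ltnNge.
move=> /rowV0Pn [u /sub_kermxP uA u0].
have Eu (y : 'rV_n) : u *m y^T = 0 -> (\sum_i u 0 i *: 'X_i : {mpoly k[n]}).@[y 0] = 0.
  move=> /matrixP /(_ 0 0); rewrite !mxE => <-; rewrite raddf_sum /=.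
  by apply: eq_bigr => i _; rewrite mevalZ mevalXU mxE.
move: uA; rewrite /A tr_col_mx mul_mx_row -(row_mx0 _ 1 1 1) => /eq_row_mx [uv uw].
exists (\sum_i u 0 i *: 'X_i); split;
  [|by apply: rpred_sum => i _; rewrite rpredZ ?form_X|exact: Eu|exact: Eu].
have [j uj] := nonzero_coord u0; apply: contraNneq uj => /(congr1 (mcoeff U_(j))).
rewrite raddf_sum /= mcoeff0 (bigD1 j) //= mcoeffZ mcoeffXU eqxx mulr1 big1 ?addr0 //.
  by move=> ->.
by move=> i ij; rewrite mcoeffZ mcoeffXU (negPf ij) mulr0.
Qed.

(** The row space of B identifies k^n with the tangent directions at v. *)
Lemma complement_mx (k : fieldType) (n : nat) (v : 'rV[k]_n.+1) : v != 0 ->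
  exists B : 'M[k]_(n, n.+1),
    (forall p, exists u s, p = u *m B + s *: v) /\
    (forall u s, u *m B = s *: v -> u = 0).
Proof.
move=> /nonzero_coord [j vj].
exists (\matrix_(i', i) (i == lift j i')%:R); split.
  move=> p; pose s := p 0 j / v 0 j; exists (\row_i (p 0 (lift j i) - s * v 0 (lift j i))), s.
  apply/rowP => i; rewrite !mxE; case: (unliftP j i) => [i' ->|->].
    rewrite (bigD1 i') //= !mxE eqxx mulr1 big1 ?addr0 ?subrK // => l li.
    by rewrite !mxE (inj_eq lift_inj) eq_sym (negPf li) mulr0.
  rewrite big1 ?add0r ?divfK // => l _.
  by rewrite !mxE (negPf (neq_lift _ _)) mulr0.
move=> u s E; have s0 : s = 0.
  move/rowP: (E) => /(_ j); rewrite !mxE big1 => [/esym/eqP|l _].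
    by rewrite mulf_eq0 (negPf vj) orbF => /eqP.
  by rewrite !mxE (negPf (neq_lift _ _)) mulr0.
apply/rowP => i; move/rowP: E => /(_ (lift j i)); rewrite !mxE s0 mul0r.
rewrite (bigD1 i) //= !mxE eqxx mulr1 big1 ?addr0 // => l li.
by rewrite !mxE (inj_eq lift_inj) eq_sym (negPf li) mulr0.
Qed.

Section Points.
Variables (k : fieldType) (n : nat).
Implicit Types (d : ppoint k n) (f : {mpoly k[n.+1]}).

Definition vec d : 'rV[k]_n.+1 := vpick (pline d).

Lemma vec0 d : vec d != 0.
Proof. by rewrite vpick0 -dimv_eq0; case: d => V /= /eqP ->. Qed.

Lemma vecE d : pline d = <[vec d]>%VS.
Proof.
apply/esym/eqP; rewrite eqEdim -memvE memv_pick dim_vline vec0.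
by case: d => V /= /eqP ->.
Qed.

Lemma ppoint_inj d d' (s : k) : vec d = s *: vec d' -> d = d'.
Proof.
move=> E; apply: val_inj => /=; rewrite !vecE E; apply/eqP; rewrite eqEdim.
rewrite -memvE memvZ ?memv_line //= !dim_vline vec0.
by rewrite -E vec0.
Qed.

Lemma ppoint_of (v : 'rV[k]_n.+1) : v != 0 -> exists d (s : k), s != 0 /\ vec d = s *: v.
Proof.
move=> v0; have H : \dim <[v]> == 1%N by rewrite dim_vline v0.
exists (PPoint H); have /vlineP [s Es] : vec (PPoint H) \in <[v]>%VS
  by exact: (memv_pick (pline (PPoint H))).
exists s; split=> //; apply: contraNneq (vec0 (PPoint H)) => s0.
by rewrite Es s0 scale0r.
Qed.

Lemma vanishes_vec d e f : f \is e.-homog -> vanishes f d <-> f.@[vec d 0] = 0.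
Proof.
move=> fe; split=> [|H v]; first by apply; apply: memv_pick.
by rewrite vecE => /vlineP [s ->]; rewrite (homog_evZ _ _ fe) H mulr0.
Qed.

Lemma point_mx_vec d f : point_mx d f <-> forall i, (pihomog mdeg i f).@[vec d 0] = 0.
Proof. by split=> H i; apply/(vanishes_vec d (pihomogP mdeg i f)). Qed.

Lemma point_mx_homog_vec d e f : f \is e.-homog -> point_mx d f <-> f.@[vec d 0] = 0.
Proof.
move=> fe; rewrite -(vanishes_vec d fe); split; last by move=> H; apply: (point_mx_homog fe).
by move=> /(_ e); rewrite pihomog_dE.
Qed.

(** Each component of an element of m_d^2 is a sum of products of two polynomials that
    vanish along the line d. *)
Lemma point_mx2_vec d f m w : point_mx2 d f ->
  (pihomog mdeg m f).@[vec d 0] = 0 /\ dir_deriv (pihomog mdeg m f) w (vec d) = 0.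
Proof.
move=> [s Hs ->]; rewrite big_seq.
have D0 : dir_deriv (0 : {mpoly k[n.+1]}) w (vec d) = 0.
  by apply: big1 => i _; rewrite mderiv0 meval0 mulr0.
have big (J : Type) (r : seq J) (P : pred J) (F : J -> {mpoly k[n.+1]}) :
    (forall j, P j -> (F j).@[vec d 0] = 0 /\ dir_deriv (F j) w (vec d) = 0) ->
    (\sum_(j <- r | P j) F j).@[vec d 0] = 0 /\ dir_deriv (\sum_(j <- r | P j) F j) w (vec d) = 0.
  move=> HF; elim/big_ind: (\sum_(j <- r | P j) F j) => [|g h [g0 dg] [h0 dh]|//].
    by rewrite meval0.
  by have := dir_derivP 1 g h w (vec d); rewrite scale1r mevalD g0 h0 dg dh mulr0 !addr0.
rewrite (big_morph _ (pihomogD mdeg m) (pihomog0 _ mdeg m)).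
apply: (big) => p /Hs [/point_mx_vec H1 /point_mx_vec H2].
rewrite pihomogM; apply: (big) => i _; apply: (big) => j _; case: eqP => // _;
  last by rewrite meval0.
by rewrite mevalM dir_derivM H1 H2 !mul0r mulr0 addr0.
Qed.

End Points.

(** * The action of R on a point module *)

Section PointData.
Variables (k : fieldType) (t : nat) (phi : proj_aut k t) (psi : graut k t.+1).
Hypothesis hpsi : induces psi phi.
Variable c : ppoint k t.
Local Notation U := {mpoly k[t.+1]}.
Local Notation R := (R_alg psi c).

Definition rval (r : R) : U := R_incl psi c r.
Definition Rgen (a : R) : Prop := deg1_vanishing c (R_incl psi c a).
Definition orb (l : nat) : ppoint k t := iter l (pa_inv phi) c.
Definition v_ (l : nat) : 'rV[k]_t.+1 := vec (orb l).

Lemma rval_inj : injective rval.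
Proof. exact: val_inj. Qed.

Lemma rval_homog m a : (a \in gcomp (ga_gr R) m) = (rval a \is m.-homog).
Proof. by rewrite -twist_compP. Qed.

Lemma rvalD a b : rval (a + b) = rval a + rval b. Proof. by []. Qed.
Lemma rval0 : rval 0 = 0. Proof. by []. Qed.
Lemma rval1 : rval 1 = 1. Proof. by []. Qed.

Lemma rvalM a b : rval (a * b) = twist_mul psi (rval a) (rval b).
Proof. by []. Qed.

Lemma rvalM_homog m a b : b \in gcomp (ga_gr R) m ->
  rval (a * b) = iter m psi (rval a) * rval b.
Proof. by rewrite rval_homog => bm; rewrite rvalM (twist_mul_homog _ _ bm). Qed.

Lemma Rgen1 a : Rgen a -> a \in gcomp (ga_gr R) 1%N.
Proof. by case. Qed.

(** The generation of R, inside R rather than inside S, so that homog_ind applies. *)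
Lemma Rgen_gen a : gen_subalg Rgen a.
Proof.
suff H b : gen_subalg (@deg1_vanishing k t psi c) b ->
    exists2 r : R, R_incl psi c r = b & gen_subalg Rgen r.
  have /gen_memP /H [r Er Hr] := gen_mem_val (a : gensub _).
  by have -> : a = r by apply/rval_inj/esym.
elim=> {b} [b Vb|s|b b' _ [r Er Hr] _ [r' Er' Hr']|b b' _ [r Er Hr] _ [r' Er' Hr']].
- have Hb : b \in gen_mem (@deg1_vanishing k t psi c) by apply/gen_memP/gen_in.
  by exists (GenSub Hb : R) => //; apply: gen_in.
- by exists s%:A => //; apply: gen_scalar.
- by exists (r + r'); [rewrite -Er -Er' | apply: gen_add].
- by exists (r * r'); [rewrite -Er -Er' | apply: gen_mul].
Qed.

Lemma psi_inj : injective psi.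
Proof. by case: (gau_bij psi) => g fK _; apply: can_inj fK. Qed.

(** psi maps the component of degree i into degree i, so it commutes with the projections. *)
Lemma psi_homog e f : psi f \is e.-homog -> f \is e.-homog.
Proof.
move=> fe; rewrite homog_piE; apply/eqP/psi_inj.
have Epi : pihomog mdeg e (psi f) = psi (pihomog mdeg e f).
  rewrite {1}(homog_parts f) raddf_sum (big_morph _ (pihomogD mdeg e) (pihomog0 _ mdeg e)).
  rewrite [in RHS](homog_parts f) (big_morph _ (pihomogD mdeg e) (pihomog0 _ mdeg e)) raddf_sum.
  apply: eq_bigr => i _; have Hi := pihomogP mdeg i f; have Hi' := gau_homog psi Hi.
  have [<-|ie] := eqVneq (i : nat) e; first by rewrite (pihomog_dE Hi) (pihomog_dE Hi').
  by rewrite (pihomog_ne0 ie Hi) (pihomog_ne0 ie Hi') raddf0.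
by rewrite -Epi pihomog_dE.
Qed.

Lemma iter_psi_surj e j g : g \is e.-homog -> exists2 f, f \is e.-homog & iter j psi f = g.
Proof.
elim: j g => [|j IH] g ge; first by exists g.
have [f fe Ef] := IH _ ge; have [h _ hK] := gau_bij psi.
exists (h f); first by apply: psi_homog; rewrite hK.
by rewrite iterSr hK.
Qed.

Lemma orb_psi j l f : point_mx (orb (j + l)) (iter j psi f) <-> point_mx (orb l) f.
Proof.
elim: j => [|j IH] //; rewrite -IH addSn /= -hpsi pa_invK //.
Qed.

Lemma orb_psi_ev e j l f : f \is e.-homog ->
  (iter j psi f).@[v_ (j + l) 0] = 0 <-> f.@[v_ l 0] = 0.
Proof.
move=> fe; rewrite -(point_mx_homog_vec _ fe) -(point_mx_homog_vec _ (iter_homog psi j fe)).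
exact: orb_psi.
Qed.

Lemma RgenP a : Rgen a <-> kills (v_ 0) (rval a).
Proof.
rewrite /Rgen /deg1_vanishing twist_compP /kills; split=> -[a1 H]; split=> //.
  by apply/(vanishes_vec _ a1).
exact/(vanishes_vec _ a1).
Qed.

(** Through psi^n, the generators (m_c)_1 are identified with the forms vanishing at c_n. *)
Lemma Rgen_iter n a : Rgen a -> kills (v_ n) (iter n psi (rval a)).
Proof.
move=> /RgenP [a1 a0]; split; first exact: iter_homog.
by rewrite -[n in v_ n]addn0 (orb_psi_ev n 0 a1).
Qed.

Lemma Rgen_lift n g : kills (v_ n) g -> exists a, Rgen a /\ iter n psi (rval a) = g.
Proof.
move=> [g1 g0]; have [f f1 Ef] := iter_psi_surj n g1.
have fV : @deg1_vanishing k t psi c f.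
  split; first by rewrite twist_compP.
  by apply/(vanishes_vec _ f1)/(orb_psi_ev n 0 f1); rewrite addn0 Ef.
have Hf : (f : twist_alg psi) \in gen_mem (@deg1_vanishing k t psi c) by apply/gen_memP/gen_in.
by exists (GenSub Hf : R).
Qed.

(** In a product, the right factor takes care of the first c_l, and the translated left
    factor of the following ones. *)
Lemma R_vanish m a : a \in gcomp (ga_gr R) m -> forall l, (l < m)%N -> (rval a).@[v_ l 0] = 0.
Proof.
move: m a; apply: (homog_ind Rgen1 Rgen_gen) =>
  [m l|m a b Ha Hb l lm|s l|a Va [|l]|i j a b ai bj Ha Hb l lij] //.
- by rewrite rval0 meval0.
- by rewrite rvalD mevalD Ha // Hb // addr0.
- by case/RgenP: Va.
rewrite (rvalM_homog _ bj) mevalM; have [lj|jl] := ltnP l j; first by rewrite Hb // mulr0.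
rewrite -(subnKC jl); rewrite rval_homog in ai.
by rewrite (_ : _.@[_] = 0) ?mul0r //; apply/(orb_psi_ev j (l - j) ai); apply: Ha; lia.
Qed.

(** The coordinates of a point module: p n matters modulo c_n and up to a scalar, since it is
    only paired with forms vanishing at c_n. *)
Record point_data (M : grmod R) (x : nat -> M) (p : nat -> 'rV[k]_t.+1) : Prop := PointData {
  pd_basis : homog_basis 0 x;
  pd_neq0 : forall n, x n != 0;
  pd_act : forall n a, Rgen a ->
    a *: x n = ((iter n psi (rval a)).@[p n 0])%:A *: x n.+1
}.

(** p l is not proportional to c_l, expressed on forms. *)
Definition nondeg_at (p : nat -> 'rV[k]_t.+1) l := exists2 h, kills (v_ l) h & h.@[p l 0] != 0.
Definition nondeg p := forall l, nondeg_at p l.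
(** Inclusion of the kernels of q l and p l on the forms vanishing at c_l.  For nondegenerate
    p it amounts to proportionality of p l and q l modulo c_l, see similar_scale. *)
Definition similar (p q : nat -> 'rV[k]_t.+1) :=
  forall l f, kills (v_ l) f -> f.@[q l 0] = 0 -> f.@[p l 0] = 0.

Lemma v_neq0 l : v_ l != 0. Proof. exact: vec0. Qed.

Lemma nondegP p : nondeg p -> exists H, forall l, kills (v_ l) (H l) /\ (H l).@[p l 0] = 1.
Proof.
move=> pn.
have /choice [H HH] : forall l, exists H : U, kills (v_ l) H /\ H.@[p l 0] = 1; last by exists H.
move=> l; have [h [h1 hv] hp] := pn l.
exists (h.@[p l 0]^-1 *: h); split; last by rewrite mevalZ mulVf.
by split; [apply: rpredZ | rewrite mevalZ hv mulr0].
Qed.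

(** The coefficient of the action of a generator from x n to x n.+1 is linear in the
    generator, hence an evaluation; it is nonzero because x 0 generates M. *)
Lemma point_data_exists M : is_point_module M -> exists x p, @point_data M x p /\ nondeg p.
Proof.
move=> /point_moduleP [x [bx x0 xgen]].
have /choice [mu Hmu] : forall ng : nat * U, exists s : k, forall a, Rgen a ->
    iter ng.1 psi (rval a) = ng.2 -> a *: x ng.1 = s%:A *: x ng.1.+1.
  move=> [n g] /=; have [[a [Va Ea]]|no] := pselect (exists a, Rgen a /\ iter n psi (rval a) = g).
    have [s Es] := hb_act bx n (Rgen1 Va); exists s => b Vb.
    rewrite -Ea => Eb; have -> : b = a; last exact: Es.
    apply: rval_inj; move: Eb; elim: (n) => //= m IH /psi_inj; exact: IH.
  by exists 0 => a Va Ea; case: no; exists a.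
have /choice [p Hp] : forall n, exists p : 'rV[k]_t.+1,
    forall f, kills (v_ n) f -> mu (n, f) = f.@[p 0].
  move=> n; apply: (functional_as_point (v_neq0 n)) => s f g Kf Kg.
  have [a [Va Ea]] := Rgen_lift Kf; have [b [Vb Eb]] := Rgen_lift Kg.
  have Eab : iter n psi (rval (s%:A * a + b)) = s *: f + g.
    by rewrite -Ea -Eb rvalD iterDp -iterZ -[X in rval X]scalerAl mul1r.
  have Vab : Rgen (s%:A * a + b).
    apply/RgenP; rewrite rvalD -[X in rval X]scalerAl mul1r.
    move/RgenP: Va => [a1 a0]; move/RgenP: Vb => [b1 b0]; split.
      by apply: rpredD => //; apply: rpredZ.
    by rewrite mevalD [X in X + _]mevalZ a0 b0 mulr0 addr0.
  apply: (scalar_inj (x0 n.+1)).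
  rewrite -(Hmu (n, s *: f + g) _ Vab Eab) scalerDl -scalerA.
  rewrite (Hmu (n, f) _ Va Ea) (Hmu (n, g) _ Vb Eb) scalarM.
  by rewrite !scalerDl.
have pd : point_data x p.
  by split=> // n a Va; rewrite (Hmu (n, iter n psi (rval a)) a Va) // Hp //; apply: Rgen_iter.
exists x, p; split=> // l.
have [a Va ax] := generator_nonzero Rgen1 Rgen_gen bx xgen (x0 l.+1).
exists (iter l psi (rval a)); first exact: Rgen_iter.
by apply: contraNneq ax => E; rewrite (pd_act pd) // E !scale0r.
Qed.

Lemma same_action_data (M N : grmod R) x y p q (P : pred nat) :
  @point_data M x p -> @point_data N y q -> (forall n, P n -> nondeg_at p n) ->
  (forall n f, P n -> kills (v_ n) f -> f.@[p n 0] = f.@[q n 0]) -> same_action Rgen x y P.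
Proof.
move=> px qy pn pq n Pn; split.
  move=> a Va; exists (iter n psi (rval a)).@[p n 0].
  by rewrite (pd_act px) // (pd_act qy) // (pq n) //; apply: Rgen_iter.
have [h Kh hp] := pn n Pn; have [a [Va Ea]] := Rgen_lift Kh.
exists a => //; rewrite (pd_act px) // Ea; apply/eqP => /scalar_eq0 [/eqP|/eqP].
  by rewrite (negPf hp).
by rewrite (negPf (pd_neq0 px _)).
Qed.

Lemma point_module_data M x p : @point_data M x p -> nondeg p -> is_point_module M.
Proof.
move=> px pn; apply/point_moduleP; exists x; split; [exact: pd_basis px|exact: pd_neq0 px|].
have sa : same_action Rgen x x predT by apply: (same_action_data px px).
apply: (hb_cyclic (pd_basis px)) => n.
by have [] := same_action_step sa (isT : predT n).
Qed.

(** An isomorphism rescales the bases, so it only rescales the functionals. *)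
Lemma point_data_iso (M N : grmod R) x y p q :
  @point_data M x p -> @point_data N y q -> gr_iso M N -> similar p q.
Proof.
move=> px qy [F [[G FK GK] Fh]] l f Kf fq.
have [a [Va Ea]] := Rgen_lift Kf.
have Fx n : exists s : k, F (x n) = s%:A *: y n.
  by apply: (hb_span (pd_basis qy)); apply/Fh/(hb_mem (pd_basis px)).
have FZ (b : R) z : F (b *: z) = b *: F z by exact: linearZ.
have [s Es] := Fx l; have := congr1 F (pd_act px l Va).
rewrite !FZ Es scalar_act (pd_act qy) // Ea fq 2!scale0r scaler0.
move=> /esym /scalar_eq0 [//|E].
by case/eqP: (pd_neq0 px l.+1); rewrite -(FK (x _)) E -(FK 0) raddf0.
Qed.

Lemma similar_scale p q : nondeg p -> similar p q ->
  exists u : nat -> k, forall l,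
    u l != 0 /\ forall f, kills (v_ l) f -> f.@[p l 0] = u l * f.@[q l 0].
Proof.
move=> pn pq.
have /choice [u Hu] : forall l, exists u : k,
    u != 0 /\ forall f, kills (v_ l) f -> f.@[p l 0] = u * f.@[q l 0]; last by exists u.
move=> l; have [h Kh hp] := pn l.
have hq : h.@[q l 0] != 0 by apply: contra hp => /eqP /(pq l _ Kh) ->.
exists (h.@[p l 0] / h.@[q l 0]); split; first by rewrite mulf_neq0 ?invr_eq0.
move=> f [f1 fv]; case: (Kh) => h1 hv.
have K : kills (v_ l) (f - (f.@[q l 0] / h.@[q l 0]) *: h).
  split; first exact: form_sub.
  by rewrite mevalB mevalZ fv hv mulr0 subr0.
have := pq l _ K; rewrite !mevalB !mevalZ divfK // subrr => /(_ erefl) /eqP.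
by rewrite subr_eq0 => /eqP ->; rewrite mulrAC [RHS]mulrAC [_ * f.@[_]]mulrC.
Qed.

Lemma point_data_rescale M x p (q : nat -> 'rV[k]_t.+1) (u : nat -> k) : @point_data M x p ->
  (forall l, u l != 0 /\ forall f, kills (v_ l) f -> f.@[p l 0] = u l * f.@[q l 0]) ->
  point_data (fun n => (\prod_(l < n) u l)%:A *: x n) q.
Proof.
move=> px Hu; have U0 n : \prod_(l < n) u l != 0.
  by apply/prodf_neq0 => l _; case: (Hu l).
split.
- split=> [n|j z|n z].
  + exact: scalar_homog (hb_mem (pd_basis px) n).
  + exact: (hb_low (pd_basis px)).
  + move=> /(hb_span (pd_basis px)) [s ->]; exists (s / \prod_(l < n) u l).
    by rewrite scalarM divfK.
- move=> n; apply/eqP => /scalar_eq0 [/eqP|/eqP].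
    by rewrite (negPf (U0 n)).
  by rewrite (negPf (pd_neq0 px n)).
move=> n a Va; rewrite scalar_act (pd_act px) // !scalarM big_ord_recr /=.
have [_ ->] := Hu n; last exact: Rgen_iter.
by congr (_%:A *: _); ring.
Qed.

(** The factors u l between p and q are absorbed by multiplying x n by u 0 ... u n.-1. *)
Lemma iso_point_data (M N : grmod R) x y p q :
  @point_data M x p -> @point_data N y q -> nondeg p -> similar p q -> gr_iso M N.
Proof.
move=> px qy pn pq; have [u Hu] := similar_scale pn pq.
have qx := point_data_rescale px Hu.
have qn : nondeg q.
  move=> l; have [h Kh hp] := pn l; exists h => //.
  by apply: contra hp => /eqP; move/(pq l _ Kh) ->.
apply: (iso_of_same_action Rgen1 Rgen_gen (pd_basis qx) (pd_neq0 qx) (pd_basis qy) (pd_neq0 qy)).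
by apply: (same_action_data qx qy).
Qed.

(** The element of R given by a product of forms acts on x 0 by the product of the values;
    it is the same element for all modules at once. *)
Lemma product_elt (G : nat -> U) n : (forall l, (l < n)%N -> kills (v_ l) (G l)) ->
  exists r : R, [/\ r \in gcomp (ga_gr R) n, rval r = \prod_(l < n) G l &
    forall M x p, @point_data M x p -> r *: x 0%N = (\prod_(l < n) (G l).@[p l 0])%:A *: x n].
Proof.
elim: n => [|n IH] HG.
  exists 1; split; first by rewrite rval_homog rval1; apply: dhomog1.
    by rewrite big_ord0.
  by move=> M x p _; rewrite big_ord0 !scale1r.
have [r [rn Er Hr]] := IH (fun l ln => HG l (ltnW ln)).
have [a [Va Ea]] := Rgen_lift (HG n (leqnn _)).
exists (a * r); split.
- by rewrite -add1n; apply: ga_mul rn; apply: Rgen1.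
- by rewrite (rvalM_homog _ rn) Ea Er big_ord_recr /= mulrC.
move=> M x p px; rewrite -scalerA (Hr _ _ _ px) scalar_act (pd_act px) // scalarM Ea.
by rewrite big_ord_recr.
Qed.

End PointData.

Lemma shifted_point_ge (k : fieldType) (t : nat) (psi : graut k t.+1) (phi : proj_aut k t)
    (hpsi : induces psi phi) (c : ppoint k t) (M : grmod (R_alg psi c)) x p (n0 : nat) :
  @point_data _ _ psi c M x p -> (forall n, (n0 <= n)%N -> nondeg_at phi c p n) ->
  is_shifted_point_module (gr_ge M n0).
Proof.
move=> px pn.
have sa := same_action_data hpsi px px pn (fun n f _ _ => erefl).
have step n := same_action_step sa (leq_addl n n0 : (fun n => (n0 <= n)%N) (n + n0)%N).
have b := hb_ge (pd_basis px) n0.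
have cyc : forall z, exists a, z = a *: ge_basis (pd_basis px) n0 0.
  apply: (hb_cyclic b) => n; have [[a Ea] _] := step n.
  by exists a; apply: val_inj.
exists (- n0%:Z), (gr_shift (gr_ge M n0) n0); split.
  apply/point_moduleP; exists (ge_basis (pd_basis px) n0); split=> //; last first.
    by move=> n; apply/eqP => /(congr1 val)/eqP; rewrite /= (negPf (pd_neq0 px _)).
  split=> [n|j z zj j0|n z zn].
  - by have := hb_mem b n; rewrite addrC addr0.
  - by apply: (hb_low b zj); rewrite gtrDl.
  - by apply: (hb_span b); rewrite addrC; move: zn; rewrite addr0.
exists (idfun : {linear _ -> _}); split; first by exists id.
move=> n z /gcompP zn; apply/gcompP.
change (gm_gr (gr_ge M n0) (n0%:Z + (- n0%:Z + n)) z = z).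
by rewrite addrA subrr add0r.
Qed.

(** * The modules P(d) and P(c_i, e) over R *)

Section ConcreteModules.
Variables (k : fieldType) (t : nat) (phi : proj_aut k t) (psi : graut k t.+1).
Hypothesis hpsi : induces psi phi.
Variable c : ppoint k t.
Local Notation U := {mpoly k[t.+1]}.
Local Notation R := (R_alg psi c).
Local Notation S := (twist_alg psi).
Local Notation v_ := (v_ phi c).
Local Notation nondeg := (nondeg phi c).

Section RestrictedPointModule.
Variable d : ppoint k t.
Local Notation v := (vec d).

Definition point_cls (f : U) : R_point psi c d := \pi_(quotm (tw_ideal psi d)) (f : gr_reg S).

Lemma point_cls_eq f g : point_cls f = point_cls g <-> point_mx d (f - g).
Proof. by rewrite quotm_pi; split=> /asboolP. Qed.

Lemma point_cls_surj z : exists f, z = point_cls f.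
Proof. by case: (quotm_surj z) => f ->; exists f. Qed.

Lemma point_cls_act (a : R) f : a *: point_cls f = point_cls (twist_mul psi (rval a) f).
Proof. exact: quotm_pi_scale. Qed.

Lemma point_cls_scalar (s : k) f : s%:A *: point_cls f = point_cls (s *: f).
Proof.
rewrite point_cls_act; congr point_cls; change (s%:A * (f : S) = s *: (f : S)).
by rewrite -scalerAl mul1r.
Qed.

Lemma point_cls_proj (n : nat) f : gm_gr (R_point psi c d) n (point_cls f) =
  point_cls (pihomog mdeg n f).
Proof. exact: quotm_proj_pi. Qed.

Lemma point_cls_proj_neg n f : n < 0 -> gm_gr (R_point psi c d) n (point_cls f) = point_cls 0.
Proof.
case: n => // n _; exact: quotm_proj_pi.
Qed.

(** The basis is formed by the classes of the powers of a linear form with value 1 at d. *)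
Lemma R_point_data : exists x, [/\ @point_data _ _ psi c (R_point psi c d) x (fun=> v) &
  x 0%N = point_cls 1].
Proof.
have [j vj] := nonzero_coord (vec0 d).
pose h : U := (v 0 j)^-1 *: 'X_j.
have h1 : form h by rewrite rpredZ ?form_X.
have hv : h.@[v 0] = 1 by rewrite mevalZ mevalXU mulVf.
have hn n : h ^+ n \is n.-homog.
  by have := dhomogMn n h1; rewrite mul1n.
have hvn n : (h ^+ n).@[v 0] = 1 by rewrite rmorphXn /= hv expr1n.
have diff n f (s : k) : f \is n.-homog -> f.@[v 0] = s -> point_cls f = s%:A *: point_cls (h ^+ n).
  move=> fn fv; rewrite point_cls_scalar; apply/point_cls_eq.
  apply/(@point_mx_homog_vec _ _ _ n).
    by rewrite -scaleNr rpredD // rpredZ // hn.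
  by rewrite mevalB mevalZ hvn fv mulr1 subrr.
exists (fun n => point_cls (h ^+ n)); split; last by rewrite expr0.
split.
- split=> [n|n z /gcompP zn n0|n z].
  + by apply/gcompP; rewrite addr0 point_cls_proj pihomog_dE.
  + have [f Ef] := point_cls_surj z; rewrite -zn Ef point_cls_proj_neg //.
    exact: (quotm_pi0 (tw_ideal psi d)).
  + have [f ->] := point_cls_surj z; rewrite addr0 => /gcompP <-; rewrite point_cls_proj.
    by eexists; apply: diff; first exact: pihomogP.
- move=> n; apply/eqP => E; have : point_cls (h ^+ n) = point_cls 0.
    by rewrite E; apply/esym/(quotm_pi0 (tw_ideal psi d)).
  move=> /point_cls_eq; rewrite subr0 => /(point_mx_homog_vec _ (hn n))/eqP.
  by rewrite hvn oner_eq0.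
move=> n a Va; rewrite point_cls_act (twist_mul_homog _ _ (hn n)).
have a1 := Rgen1 Va; rewrite rval_homog in a1.
apply: diff; first exact: (dhomogM (iter_homog psi n a1) (hn n)).
by rewrite mevalM hvn mulr1.
Qed.

End RestrictedPointModule.

Section TangentModule.
Variables (i : nat) (w : 'rV[k]_t.+1).
Local Notation v := (v_ i).

(** The functional whose kernel in R_n is the component of degree n of the point ideal.
    Elements of R_n vanish at c_i as soon as n > i, and the first derivative takes over. *)
Definition omega n (f : U) : k := if (n <= i)%N then f.@[v 0] else dir_deriv f w v.

Lemma omegaP n (s : k) f g : omega n (s *: f + g) = s * omega n f + omega n g.
Proof. by rewrite /omega; case: ifP => _; [rewrite mevalD mevalZ | apply: dir_derivP]. Qed.

Lemma omega0 n : omega n 0 = 0.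
Proof.
by apply: (addrI (omega n 0)); have := omegaP n 1 0 0; rewrite scale1r mul1r !addr0 => <-.
Qed.

Lemma omegaD n f g : omega n (f + g) = omega n f + omega n g.
Proof. by have := omegaP n 1 f g; rewrite scale1r mul1r. Qed.

Lemma omegaB n f g : omega n (f - g) = omega n f - omega n g.
Proof. by have := omegaP n (-1) g f; rewrite scaleN1r mulN1r addrC => ->; rewrite addrC. Qed.

(** The factor by which left multiplication by a changes the functionals omega: the
    derivative appears exactly when the product crosses the degree i. *)
Definition kappa m j (a : R) : k :=
  let f := iter j psi (rval a) in
  if (j <= i < m + j)%N then dir_deriv f w v else f.@[v 0].

(** Beyond degree i this is the Leibniz rule, one of whose terms vanishes: if j > i then b vanishes
    at c_i, and if j <= i < m + j then the translate of a does. *)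
Lemma omegaM m j a b : a \in gcomp (ga_gr R) m -> b \in gcomp (ga_gr R) j ->
  omega (m + j)%N (rval (a * b)) = kappa m j a * omega j (rval b).
Proof.
move=> am bj; rewrite (rvalM_homog _ bj) /omega /kappa.
have [ji|ij] := leqP j i; have [mji|imj] /= := leqP (m + j) i.
- by rewrite mevalM.
- rewrite dir_derivM (_ : (iter _ _ _).@[_] = 0) ?mul0r ?addr0 //.
  rewrite -(subnKC ji); move: (am); rewrite rval_homog => am'.
  by apply/(orb_psi_ev hpsi c j (i - j) am')/(R_vanish hpsi am); lia.
- lia.
by rewrite dir_derivM (R_vanish hpsi bj ij) mulr0 add0r.
Qed.

Definition Omega n (r : R) : k := omega n (rval (ga_gr R n r)).

Lemma OmegaD n : {morph Omega n : r s / r + s}.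
Proof. by move=> r s; rewrite /Omega gprojD rvalD omegaD. Qed.

Lemma Omega0 n : Omega n 0 = 0.
Proof. by rewrite /Omega gproj0 omega0. Qed.

Lemma Omega_homog m n r : r \in gcomp (ga_gr R) m ->
  Omega n r = if n == m then omega m (rval r) else 0.
Proof.
move=> rm; case: eqP => [->|/eqP nm]; first by rewrite /Omega (gcompP _ _ _ rm).
by rewrite /Omega (gproj_neq rm nm) omega0.
Qed.

Definition tangent_mem (r : gr_reg R) : bool := `[< forall n, Omega n r = 0 >].

Lemma tangent_closed : submod_closed tangent_mem.
Proof.
split=> [|a x y /asboolP Hx /asboolP Hy]; apply/asboolP => n; first exact: Omega0.
rewrite OmegaD Hy addr0; change (Omega n ((a : R) * (x : R)) = 0).
have [s _ ->] := gproj_sum (ga_gr R) a; have [s' _ Ex] := gproj_sum (ga_gr R) x.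
rewrite mulr_suml (big_morph _ (OmegaD n) (Omega0 n)) big1 // => m _.
rewrite {1}Ex mulr_sumr (big_morph _ (OmegaD n) (Omega0 n)) big1 // => j _.
have am := gproj_in (ga_gr R) m a; have xj := gproj_in (ga_gr R) j x.
rewrite (Omega_homog _ (ga_mul am xj)) omegaM // -[omega j _]/(Omega j x) Hx mulr0.
by case: ifP.
Qed.

Lemma tangent_graded n r : r \in tangent_mem -> gm_gr (gr_reg R) n r \in tangent_mem.
Proof.
move=> /asboolP Hr; apply/asboolP => m; case: n => n; last exact: Omega0.
change (omega m (rval (ga_gr R m (ga_gr R n r))) = 0); rewrite gproj_orth.
by case: eqP => [->|_]; [exact: Hr | exact: omega0].
Qed.

Definition tangent_ideal : grsub (gr_reg R) := GrSub tangent_closed tangent_graded.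
(** P(c_i, e), for a vector w in the tangent direction e at c_i. *)
Definition tangent_module : grmod R := gr_quot tangent_ideal.

Definition tangent_cls (r : R) : tangent_module := \pi_(quotm tangent_ideal) (r : gr_reg R).

Lemma tangent_cls_eq r s : tangent_cls r = tangent_cls s <-> forall n, Omega n (r - s) = 0.
Proof. by rewrite quotm_pi; split=> /asboolP. Qed.

Lemma tangent_cls_act (a : R) r : a *: tangent_cls r = tangent_cls (a * r).
Proof. exact: quotm_pi_scale. Qed.

Lemma tangent_cls_proj (n : nat) r : gm_gr tangent_module n (tangent_cls r) =
  tangent_cls (ga_gr R n r).
Proof. exact: quotm_proj_pi. Qed.

Definition tangent_pts l : 'rV[k]_t.+1 := if l == i then w else v.

Lemma omega_Rgen n a r : Rgen a -> r \in gcomp (ga_gr R) n ->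
  omega n.+1 (rval (a * r)) = (iter n psi (rval a)).@[tangent_pts n 0] * omega n (rval r).
Proof.
move=> Va rn; have := omegaM (Rgen1 Va) rn; rewrite add1n => ->; congr (_ * _).
rewrite /kappa /tangent_pts add1n ltnS -eqn_leq; case: eqP => // _.
by apply: dir_deriv_form; case: (Rgen_iter hpsi n Va).
Qed.

(** The basis is the class of elements g n normalized by omega n (g n) = 1, obtained as
    products of forms on which the functionals do not vanish. *)
Lemma tangent_module_data : nondeg tangent_pts -> exists g : nat -> R,
  (forall n, g n \in gcomp (ga_gr R) n /\ omega n (rval (g n)) = 1) /\
  [/\ @point_data _ _ psi c tangent_module (fun n => tangent_cls (g n)) tangent_pts &
      forall r, point_ideal tangent_module r <-> forall n, Omega n r = 0].
Proof.
move=> pn.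
have /choice [g Hg] : forall n, exists r : R, r \in gcomp (ga_gr R) n /\ omega n (rval r) = 1.
  elim=> [|n [r [rn Er]]].
    by exists 1; rewrite rval_homog rval1 dhomog1 /omega /= meval1.
  have [h Kh hp] := pn n; have [a [Va Ea]] := Rgen_lift hpsi Kh.
  exists ((h.@[tangent_pts n 0])^-1%:A * (a * r)); split.
    rewrite -[n.+1]add0n; apply: ga_mul (ga_scalar R _) _.
    by rewrite -add1n; apply: ga_mul rn; apply: Rgen1.
  rewrite -[X in rval X]scalerAl mul1r -[rval _]addr0.
  change (omega n.+1 ((h.@[tangent_pts n 0])^-1 *: rval (a * r) + 0) = 1).
  by rewrite omegaP omega0 addr0 omega_Rgen // Ea Er mulr1 mulVf.
have gn n : g n \in gcomp (ga_gr R) n by case: (Hg n).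
have g1 n : omega n (rval (g n)) = 1 by case: (Hg n).
exists g; split=> //.
have diff n r (s : k) : r \in gcomp (ga_gr R) n -> omega n (rval r) = s ->
    tangent_cls r = s%:A *: tangent_cls (g n).
  move=> rn Er; rewrite tangent_cls_act; apply/tangent_cls_eq => m.
  have sn : s%:A * g n \in gcomp (ga_gr R) n.
    by rewrite -[n]add0n; apply: ga_mul (ga_scalar R _) (gn n).
  have rsn : r - s%:A * g n \in gcomp (ga_gr R) n.
    by apply/gcompP; rewrite gprojB (gcompP _ _ _ rn) (gcompP _ _ _ sn).
  rewrite (Omega_homog _ rsn); case: eqP => // _.
  rewrite [rval _]/(rval r - rval (s%:A * g n)) omegaB Er -[X in rval X]scalerAl mul1r.
  change (s - omega n (s *: rval (g n)) = 0).
  by rewrite -[_ *: _]addr0 omegaP omega0 addr0 g1 mulr1 subrr.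
have b : homog_basis 0 (fun n => tangent_cls (g n)).
  split=> [n|n z /gcompP zn n0|n z].
  - by apply/gcompP; rewrite addr0 tangent_cls_proj (gcompP _ _ _ (gn n)).
  - case: n n0 zn => // n _ <-; case: (quotm_surj z) => r ->.
    by rewrite /= quotm_proj_pi quotm_pi0.
  case: (quotm_surj z) => r ->; rewrite addr0 => /gcompP <-; rewrite tangent_cls_proj.
  by eexists; apply: diff; first exact: gproj_in.
split.
- split=> //.
  + move=> n; apply/eqP => E; have : tangent_cls (g n) = tangent_cls 0.
      by rewrite E; apply/esym/(quotm_pi0 tangent_ideal).
    move=> /tangent_cls_eq /(_ n); rewrite subr0 (Omega_homog _ (gn n)) eqxx g1 => /eqP.
    by rewrite oner_eq0.
  move=> n a Va; rewrite tangent_cls_act; apply: diff.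
    by rewrite -add1n; apply: ga_mul (gn n); apply: Rgen1.
  by rewrite omega_Rgen // g1 mulr1.
move=> r; rewrite (point_ideal_basis _ b) tangent_cls_act.
have -> : (0 : tangent_module) = tangent_cls 0 by apply/esym/(quotm_pi0 tangent_ideal).
have E1 : tangent_cls (g 0%N) = tangent_cls 1.
  have one0 : (1 : R) \in gcomp (ga_gr R) 0%N by rewrite rval_homog rval1 dhomog1.
  by rewrite (diff 0%N 1 1 one0) ?scalar1 // /omega /= rval1 meval1.
rewrite -tangent_cls_act E1 tangent_cls_act mulr1 tangent_cls_eq subr0 //.
Qed.

End TangentModule.
End ConcreteModules.

Lemma R_point_ideal (k : fieldType) (t : nat) (psi : graut k t.+1) (c d : ppoint k t)
    (r : R_alg psi c) :
  point_ideal (R_point psi c d) r <-> point_mx d (R_incl psi c r).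
Proof.
have [x [px x0]] := R_point_data psi c d.
rewrite (point_ideal_basis _ (pd_basis px)) x0 point_cls_act.
have -> : twist_mul psi (rval r) 1 = rval r by apply: twist_mul1r.
have -> : (0 : R_point psi c d) = point_cls psi c d 0 by apply/esym/(quotm_pi0 (tw_ideal psi d)).
by rewrite point_cls_eq subr0.
Qed.

(** * Projections from the orbit points *)

Lemma prod_split3 (A : comNzRingType) (F : nat -> A) (n i j l : nat) :
  (i < n)%N -> (j < n)%N -> (l < n)%N -> i != j -> i != l -> j != l ->
  \prod_(q < n) F q = F i * F j * F l *
    \prod_(q < n | [&& q != i :> nat, q != j :> nat & q != l :> nat]) F q.
Proof.
move=> iN jn ln ij il jl.
rewrite (bigD1 (Ordinal iN)) //= (bigD1 (Ordinal jn)) /=; last by rewrite -val_eqE /= eq_sym.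
rewrite (bigD1 (Ordinal ln)) /=; last by rewrite -!val_eqE /= ![l == _]eq_sym il.
by rewrite !mulrA; congr (_ * _); apply: eq_bigl => q; rewrite -!val_eqE /= andbA.
Qed.

(** A hyperplane containing all c_l with l >= 0 would be a proper closed set with infinitely
    many orbit points. *)
Lemma critical_density_orbit (k : fieldType) (t : nat) (phi : proj_aut k t) (c : ppoint k t) :
  critical_density phi c -> injective (orb phi c) /\
  forall f : {mpoly k[t.+1]}, form f -> f != 0 -> exists l, f.@[v_ phi c l 0] != 0.
Proof.
move=> [inj [_ dense]]; split.
  by move=> i j E; have [] := inj (Posz i) (Posz j) E.
move=> f f1 f0; apply: contrapT => H.
have Hv l : vanishes f (orb phi c l).
  apply/(vanishes_vec _ f1)/eqP; apply: contrapT => /negP fl; apply: H; by exists l.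
have closedX : zariski_closed (vanishes f).
  exists (eq f) => [_ <-|d]; first by exists 1%N.
  by split=> [fd _ <-|]; last apply.
have properX : exists d, ~ vanishes f d.
  have [j fj] : exists j, f@_U_(j) != 0.
    apply: contrapT => fj; move/eqP: f0; apply; rewrite (form_sum f1) big1 // => j _.
    apply/eqP; apply: contrapT => fj'; apply: fj; exists j.
    by apply: contra_notN fj' => /eqP ->; rewrite scale0r.
  pose v : 'rV[k]_t.+1 := delta_mx 0 j.
  have v0 : v != 0.
    by apply/eqP => /rowP /(_ j); rewrite !mxE !eqxx => /eqP; rewrite oner_eq0.
  have [d [s [s0 Ed]]] := ppoint_of v0; exists d => /(vanishes_vec _ f1)/eqP.
  rewrite Ed form_evZ // form_ev // (bigD1 j) //= big1 => [|i ij].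
    by rewrite mxE !eqxx mulr1 addr0 mulf_eq0 (negPf s0) (negPf fj).
  by rewrite mxE (negPf ij) andbF mulr0.
have [s Hs] := dense _ closedX properX.
have orb_s l : orb phi c l \in s by apply: Hs; split; [exists (Posz l) | apply: Hv].
have u : uniq (map (orb phi c) (iota 0 (size s).+1)).
  rewrite map_inj_uniq ?iota_uniq // => i j E.
  by have [] := inj (Posz i) (Posz j) E.
have /(uniq_leq_size u) : {subset map (orb phi c) (iota 0 (size s).+1) <= s}.
  by move=> d /mapP [l _ ->].
by rewrite size_map size_iota ltnn.
Qed.

Section Classification.
Variables (k : fieldType) (t : nat) (phi : proj_aut k t) (psi : graut k t.+1).
Hypothesis hpsi : induces psi phi.
Variable c : ppoint k t.
Hypothesis t2 : (2 <= t)%N.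
Hypothesis orb_inj : injective (orb phi c).
Local Notation U := {mpoly k[t.+1]}.
Local Notation R := (R_alg psi c).
Local Notation orb := (orb phi c).
Local Notation v_ := (v_ phi c).
Local Notation kl l := (kills (v_ l)).
Local Notation nondeg := (nondeg phi c).
Local Notation nondeg_at := (nondeg_at phi c).
Local Notation similar := (similar phi c).
Hypothesis gen_pos : forall f : U, form f -> f != 0 -> exists l, f.@[v_ l 0] != 0.

Section Relations.
Variables (M : grmod R) (x : nat -> M) (p : nat -> 'rV[k]_t.+1).
Hypotheses (px : point_data x p) (pn : nondeg p).

(** A combination of tensors in L_i, L_j and L_l that multiplies to zero in U is completed,
    in the other slots, by fixed forms H q with value 1 at p q; this is zero in R, so it
    kills x 0.  The list s holds the tensors. *)
Lemma action_relation3 i j l (s : seq (U * U * U)) : i != j -> i != l -> j != l ->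
  (forall T, T \in s -> [/\ kl i T.1.1, kl j T.1.2 & kl l T.2]) ->
  \sum_(T <- s) T.1.1 * T.1.2 * T.2 = 0 ->
  \sum_(T <- s) T.1.1.@[p i 0] * T.1.2.@[p j 0] * T.2.@[p l 0] = 0.
Proof.
move=> ij il jl Hs Hsum; have [H HH] := nondegP pn.
pose n := (i + j + l).+1.
have iN : (i < n)%N by rewrite /n; lia.
have jn : (j < n)%N by rewrite /n; lia.
have ln : (l < n)%N by rewrite /n; lia.
pose G (T : U * U * U) q := if q == i then T.1.1 else if q == j then T.1.2
  else if q == l then T.2 else H q.
have GE (T : U * U * U) : [/\ G T i = T.1.1, G T j = T.1.2 & G T l = T.2].
  by rewrite /G !eqxx ![j == _]eq_sym ![l == _]eq_sym (negPf ij) (negPf il) (negPf jl).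
have Grest T q : [&& q != i, q != j & q != l] -> G T q = H q.
  by case/and3P=> qi qj ql; rewrite /G (negPf qi) (negPf qj) (negPf ql).
have /choice [r Hr] : forall T, exists r : R, T \in s ->
    rval r = \prod_(q < n) G T q /\ r *: x 0%N = (\prod_(q < n) (G T q).@[p q 0])%:A *: x n.
  move=> T; have [Ts|] := boolP (T \in s); last by exists 0.
  have [|r [_ Er Hr]] := @product_elt _ _ _ _ hpsi c (G T) n; last first.
    by exists r => _; split=> //; apply: Hr px.
  move=> q _; have [Ti Tj Tl] := Hs T Ts; rewrite /G.
  case: eqP => [->|_] //; case: eqP => [->|_] //; case: eqP => [->|_] //.
  by case: (HH q).
pose rest := \prod_(q < n | [&& q != i :> nat, q != j :> nat & q != l :> nat]) H q.
have r0 : \sum_(T <- s) r T = 0.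
  apply: rval_inj; rewrite rval0.
  rewrite (big_morph (@rval _ _ psi c) (@rvalD _ _ psi c) (@rval0 _ _ psi c)).
  transitivity ((\sum_(T <- s) T.1.1 * T.1.2 * T.2) * rest); last by rewrite Hsum mul0r.
  rewrite mulr_suml big_seq [RHS]big_seq; apply: eq_bigr => T /Hr [-> _].
  rewrite (prod_split3 (G T) iN jn ln ij il jl); have [-> -> ->] := GE T; congr (_ * _).
  by apply: eq_bigr => q; apply: Grest.
have : (\sum_(T <- s) r T) *: x 0%N =
    (\sum_(T <- s) T.1.1.@[p i 0] * T.1.2.@[p j 0] * T.2.@[p l 0])%:A *: x n.
  rewrite !scaler_suml big_seq [RHS]big_seq; apply: eq_bigr => T /Hr [_ ->].
  rewrite (prod_split3 (fun q => (G T q).@[p q 0]) iN jn ln ij il jl); have [-> -> ->] := GE T.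
  rewrite [X in _ * X]big1 ?mulr1 // => q qn; rewrite (Grest T q qn).
  by case: (HH q).
rewrite r0 scale0r => /esym /scalar_eq0 [//|E].
by have := pd_neq0 px n; rewrite E eqxx.
Qed.

(** Geometrically: the lines from c_i to p_i and from c_j to p_j meet. *)
Lemma action_swap i j f g : i != j -> kl i f -> kl j f -> kl i g -> kl j g ->
  f.@[p i 0] * g.@[p j 0] = g.@[p i 0] * f.@[p j 0].
Proof.
move=> ij fi fj gi gj; have [H HH] := nondegP pn; pose l := (i + j).+1.
have il : i != l by rewrite /l; lia.
have jl : j != l by rewrite /l; lia.
have [Hl1 Hl2] := HH l.
(* f g = g f, with the third slot filled by H l *)
have := @action_relation3 i j l [:: (f, g, H l); (- g, f, H l)] ij il jl.
rewrite !big_cons !big_nil /= Hl2 mevalN !mulr1 !addr0 => E.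
have {}E : f.@[p i 0] * g.@[p j 0] + - g.@[p i 0] * f.@[p j 0] = 0.
  apply: E; last by ring.
  by move=> T; rewrite !inE => /orP [/eqP ->|/eqP ->] /=; split=> //; apply: kills_opp.
by apply/eqP; rewrite -subr_eq0 -mulNr E.
Qed.

(** For some i and j, the point p_i is off the line through c_i and c_j.  Otherwise p_0 lies
    on the line through c_0 and c_j for all j, so that every c_j is on the line through c_0
    and p_0, and a fortiori on a hyperplane. *)
Lemma nondegenerate_pair : exists i j f, [/\ i != j, kl i f, kl j f & f.@[p i 0] != 0].
Proof.
have [f [f0 f1 fv fp]] := form_through_two_points (v_ 0) (p 0%N) t2.
have [j fj] := gen_pos f1 f0; have [h [h1 hv] hp] := pn 0.
exists 0%N, j, (h - (h.@[v_ j 0] / f.@[v_ j 0]) *: f).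
have g1 : form (h - (h.@[v_ j 0] / f.@[v_ j 0]) *: f).
  exact: form_sub.
split.
- by apply: contraNneq fj => <-; rewrite fv.
- by split=> //; rewrite mevalB mevalZ fv hv mulr0 subrr.
- exact: kills_elim.
- by rewrite mevalB mevalZ fp mulr0 subr0.
Qed.

Lemma orbit_vec_indep i j s : i != j -> v_ i <> s *: v_ j.
Proof. by move=> ij /ppoint_inj /orb_inj /eqP; rewrite (negPf ij). Qed.

(** The vector d0 spans the intersection of the lines c_i p_i and c_j p_j.  As a functional
    on forms it is a |-> a_i(p_i) f(p_j) + f(p_i) a_j(p_j) for any splitting a = a_i + a_j
    with a_i in L_i and a_j in L_j, where f lies in both L_i and L_j and f(p_i) is nonzero;
    this is the action of the product a f, which belongs to L_i L_j.  For a third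
    index l, the product g h f with g, h in L_l can be read in the slots i, j, l with either
    g or h in the slot l, so that g(p_l) h(d0) = h(p_l) g(d0). *)
Lemma common_point : exists d : ppoint k t, forall l, d <> orb l ->
  forall f, kl l f -> f.@[vec d 0] = 0 -> f.@[p l 0] = 0.
Proof.
have [H HH] := nondegP pn.
have [i [j [f [ij fi fj fpi]]]] := nondegenerate_pair.
have [e [e1 ej ei]] := separating_form (v_neq0 phi c j) (fun s => @orbit_vec_indep i j s ij).
pose kap := f.@[p i 0] * e.@[p j 0] - f.@[p j 0] * e.@[p i 0].
pose d0 : 'rV[k]_t.+1 := f.@[p j 0] *: p i + kap *: v_ i.
have d0E g : form g -> g.@[d0 0] = f.@[p j 0] * g.@[p i 0] + kap * g.@[v_ i 0].
  by move=> g1; rewrite form_evD // form_evZ.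
(* a = (a - a(c_i) e) + a(c_i) e splits a form a between L_i and L_j *)
have split_i g : form g -> kl i (g - g.@[v_ i 0] *: e).
  move=> g1; split; first exact: form_sub.
  by rewrite mevalB mevalZ ei mulr1 subrr.
have split_j (s : k) : kl j (s *: e).
  by split; [apply: rpredZ | rewrite mevalZ ej mulr0].
have dj g : kl j g -> g.@[d0 0] = f.@[p i 0] * g.@[p j 0].
  move=> [g1 gj]; rewrite d0E // /kap.
  have K : kl j (g - g.@[v_ i 0] *: e).
    by split; [case: (split_i g g1) | rewrite mevalB mevalZ gj ej mulr0 subrr].
  have := action_swap ij fi fj (split_i g g1) K; rewrite !mevalB !mevalZ => E.
  apply/eqP; rewrite -subr_eq0; apply/eqP.
  transitivity ((g.@[p i 0] - g.@[v_ i 0] * e.@[p i 0]) * f.@[p j 0] -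
    f.@[p i 0] * (g.@[p j 0] - g.@[v_ i 0] * e.@[p j 0])); first by ring.
  by rewrite E subrr.
have dl l g : l != i -> l != j -> kl l g -> g.@[d0 0] = (H l).@[d0 0] * g.@[p l 0].
  move=> li lj gl; have [Hl Hl1] := HH l; set h := H l in Hl Hl1 *.
  case: (gl) (Hl) => g1 _ [h1 _].
  (* g f h = h f g, where g on the left and h on the right are split between L_i and L_j *)
  have := @action_relation3 i j l [:: (g - g.@[v_ i 0] *: e, f, h); (f, g.@[v_ i 0] *: e, h);
    (- (h - h.@[v_ i 0] *: e), f, g); (- f, h.@[v_ i 0] *: e, g)].
  rewrite ![_ == l]eq_sym => /(_ ij li lj).
  rewrite !big_cons !big_nil /= !addr0 !(mevalN, mevalB, mevalZ) Hl1 => E.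
  rewrite !d0E // /kap; apply/eqP; rewrite -subr_eq0; apply/eqP.
  rewrite -[RHS]E; first by ring.
    move=> T; rewrite !inE.
    by case/or4P=> /eqP -> /=; split=> //; try (exact: split_i);
      apply: kills_opp => //; apply: split_i.
  by rewrite -!mul_mpolyC; ring.
have d00 : d0 != 0.
  apply/eqP => E; have [Hj Hj1] := HH j; have := dj _ Hj.
  rewrite Hj1 mulr1 E => Ef; move: fpi; rewrite -Ef.
  by case: Hj => Hj _; rewrite form_ev // big1 ?eqxx // => q _; rewrite mxE mulr0.
have prop l : exists s, forall g, kl l g -> g.@[d0 0] = s * g.@[p l 0].
  have [->|li] := eqVneq l i.
    by exists f.@[p j 0] => g [g1 g0]; rewrite d0E // g0 mulr0 addr0.
  have [->|lj] := eqVneq l j; first by exists f.@[p i 0].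
  by exists (H l).@[d0 0] => g; apply: dl.
have [d [u [u0 Ed]]] := ppoint_of d00.
exists d => l dorb g gl; have [s Hs] := prop l.
have gE : g.@[vec d 0] = u * (s * g.@[p l 0]).
  by rewrite Ed -Hs // form_evZ //; case: gl.
(* s = 0 means that every form vanishing at c_l vanishes at d0 *)
have [s0|s0] := eqVneq s 0.
  case: dorb; have [h h1 hv|r Er] := @colinear_of_forms _ _ (vec d) (v_ l) (v_neq0 phi c l).
    by rewrite Ed form_evZ // Hs // s0 mul0r mulr0.
  exact: ppoint_inj Er.
by rewrite gE => /eqP; rewrite mulf_eq0 (negPf u0) mulf_eq0 (negPf s0) /= => /eqP.
Qed.

End Relations.

Lemma nondeg_off_orbit d : (forall l, d <> orb l) -> nondeg (fun=> vec d).
Proof.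
move=> dorb l; have [|f [f1 fv fd]] := @separating_form _ _ (vec d) (v_ l) (v_neq0 phi c l).
  by move=> s /ppoint_inj; apply: dorb.
by exists f => //; rewrite fd oner_eq0.
Qed.

Lemma nondeg_at_orbit i l : l != i -> nondeg_at (fun=> v_ i) l.
Proof.
move=> li; have [|f [f1 fv fd]] := @separating_form _ _ (v_ i) (v_ l) (v_neq0 phi c l).
  by move=> s; apply: orbit_vec_indep; rewrite eq_sym.
by exists f => //; rewrite fd oner_eq0.
Qed.

Lemma nondeg_tangent i w : (forall s, w <> s *: v_ i) -> nondeg (tangent_pts phi c i w).
Proof.
move=> wv l; rewrite /nondeg_at /tangent_pts; case: (eqVneq l i) => [->|li].
  have [f [f1 fv fw]] := separating_form (v_neq0 phi c i) wv.
  by exists f => //; rewrite fw oner_eq0.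
exact: nondeg_at_orbit.
Qed.

(** Equal projections of d and d' from c_l mean that c_l lies on the line through d and d',
    and some c_l avoids any given hyperplane containing this line. *)
Lemma points_separated d d' : d <> d' ->
  ~ (forall l, d <> orb l -> d' <> orb l ->
       forall f, kl l f -> f.@[vec d' 0] = 0 -> f.@[vec d 0] = 0).
Proof.
move=> dd' H; have [f [f0 f1 fd fd']] := form_through_two_points (vec d) (vec d') t2.
have [l fl] := gen_pos f1 f0.
have [|g [g1 gd' gd]] := @separating_form _ _ (vec d) (vec d') (vec0 d').
  by move=> s /ppoint_inj.
have K : kl l (g - (g.@[v_ l 0] / f.@[v_ l 0]) *: f) by apply: kills_elim.
have off q : f.@[vec q 0] = 0 -> q <> orb l.
  by move=> fq E; move: fl; rewrite /v_ -E fq eqxx.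
have := H l (off _ fd) (off _ fd') _ K; rewrite !mevalB !mevalZ gd gd' fd fd' mulr0 !subr0.
by move=> /(_ erefl)/eqP; rewrite oner_eq0.
Qed.

End Classification.

(** * The families of tangent modules *)

Section TangentFamily.
Variables (k : fieldType) (t : nat) (phi : proj_aut k t.+1) (psi : graut k t.+2).
Hypothesis hpsi : induces psi phi.
Variable c : ppoint k t.+1.
Hypothesis orb_inj : injective (orb phi c).
Local Notation U := {mpoly k[t.+2]}.
Local Notation R := (R_alg psi c).
Local Notation orb := (orb phi c).
Local Notation v_ := (v_ phi c).
Local Notation kl l := (kills (v_ l)).
Local Notation nondeg := (nondeg phi c).
Variable B : nat -> 'M[k]_(t.+1, t.+2).
Hypothesis Bspan : forall i p, exists u s, p = u *m B i + s *: v_ i.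
Hypothesis Bfree : forall i u s, u *m B i = s *: v_ i -> u = 0.

(** The tangent directions at c_i are parametrized through the rows of B i. *)
Definition tangent_family (i : nat) (e : ppoint k t) : grmod R :=
  tangent_module hpsi c i (vec e *m B i).
Local Notation pts i e := (tangent_pts phi c i (vec e *m B i)).

Lemma nondeg_tangent_family i e : nondeg (pts i e).
Proof.
apply: nondeg_tangent orb_inj _ _ _ => s /Bfree E.
by have := vec0 e; rewrite E eqxx.
Qed.

Lemma tangent_family_data i e : exists x, @point_data _ _ psi c (tangent_family i e) x (pts i e).
Proof.
by have [g [_ [px _]]] := tangent_module_data hpsi (nondeg_tangent_family i e); eexists; exact: px.
Qed.

Lemma tangent_family_ideal i e r : point_ideal (tangent_family i e) r <->
  forall n, Omega phi i (vec e *m B i) n r = 0.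
Proof. by have [g [_ [_ ->]]] := tangent_module_data hpsi (nondeg_tangent_family i e). Qed.

Lemma tangent_family_point_module i e : is_point_module (tangent_family i e).
Proof.
have [x px] := tangent_family_data i e; apply: (point_module_data hpsi px).
exact: nondeg_tangent_family.
Qed.

Lemma tangent_family_inj i e e' : gr_iso (tangent_family i e) (tangent_family i e') -> e = e'.
Proof.
have [x px] := tangent_family_data i e.
have [y py] := tangent_family_data i e' => /(point_data_iso hpsi px py) /(_ i).
rewrite /tangent_pts eqxx => H.
have [h [h1 hv] hw] : exists2 h, kl i h & h.@[(vec e' *m B i) 0] != 0.
  by have := nondeg_tangent_family i e' i; rewrite /nondeg_at /tangent_pts eqxx.
pose w := vec e *m B i; pose w' := vec e' *m B i.
pose s := h.@[w 0] / h.@[w' 0].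
have [f f1 fv|r Er] := @colinear_of_forms _ _ (w - s *: w') (v_ i) (v_neq0 phi c i).
  rewrite addrC -scaleNr form_evD //.
  have K : kl i (f - (f.@[w' 0] / h.@[w' 0]) *: h).
    split; first exact: form_sub.
    by rewrite mevalB mevalZ fv hv mulr0 subr0.
  have := H _ K; rewrite !mevalB !mevalZ divfK // subrr => /(_ erefl) E.
  by rewrite -[RHS]E /s; ring.
apply: (@ppoint_inj _ _ _ _ s); apply/eqP; rewrite -subr_eq0; apply/eqP.
by apply: (@Bfree i _ r); rewrite mulmxBl -scalemxAl.
Qed.

(** P(c_i, e) and P(c_i) have the same coordinates outside the position i, and neither
    truncation involves the step from i to i + 1. *)
Lemma tangent_family_truncations i e :
  gr_iso (gr_ge (tangent_family i e) i.+1) (gr_ge (R_point psi c (orb i)) i.+1) /\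
  gr_iso (gr_le (tangent_family i e) i) (gr_le (R_point psi c (orb i)) i).
Proof.
have [x px] := tangent_family_data i e; have [y [py _]] := R_point_data psi c (orb i).
have sa (P : pred nat) : (forall n, P n -> n != i) -> same_action (@Rgen _ _ psi c) x y P.
  move=> Pi; apply: (same_action_data hpsi px py) => [n _|n f /Pi ni _].
    exact: nondeg_tangent_family.
  by rewrite /tangent_pts (negPf ni).
split.
  apply: (iso_ge (@Rgen1 _ _ psi c) (@Rgen_gen _ _ psi c)
    (pd_basis px) (pd_neq0 px) (pd_basis py) (pd_neq0 py)).
  by apply: sa => n; case: eqP => [->|//]; rewrite ltnn.
apply: (iso_le (@Rgen1 _ _ psi c) (@Rgen_gen _ _ psi c)
    (pd_basis px) (pd_neq0 px) (pd_basis py) (pd_neq0 py)).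
by apply: sa => n; case: eqP => [->|//]; rewrite ltnn.
Qed.

(** Modulo c_i, the vector p i is a combination of the rows of B i; e is the point given by
    its coefficients. *)
Lemma iso_tangent_family M x p i : @point_data _ _ psi c M x p -> nondeg p ->
  (forall l, l != i -> forall f, kl l f -> f.@[v_ i 0] = 0 -> f.@[p l 0] = 0) ->
  exists e, gr_iso M (tangent_family i e).
Proof.
move=> px pn H; have [u [s Ep]] := Bspan i (p i).
have u0 : u != 0.
  apply/eqP => E; have [h [h1 hv] hp] := pn i.
  by move: hp; rewrite Ep E mul0mx add0r form_evZ // hv mulr0 eqxx.
have [e [r [r0 Ee]]] := ppoint_of u0; exists e; have [y py] := tangent_family_data i e.
apply: (iso_point_data hpsi px py pn) => l f Kf; rewrite /tangent_pts.
case: (eqVneq l i) => [El|li]; last exact: H.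
case: Kf; rewrite El => f1 fv; rewrite Ee -scalemxAl form_evZ //.
rewrite Ep addrC form_evD // fv mulr0 add0r.
by move=> /eqP; rewrite mulf_eq0 (negPf r0) => /eqP.
Qed.

(** If p_l were not c_i, some f in L_l would vanish at c_i and not at p_l.  The product
    having f in the slot l and any form of L_i in the slot i lies in m_(c_i)^2, and it acts
    on x 0 by f(p_l) once the other forms are normalized. *)
Lemma tangent_family_square i M : is_point_module M ->
  (forall r : R, point_mx2 (orb i) (R_incl psi c r) -> point_ideal M r) <->
  exists e, gr_iso M (tangent_family i e).
Proof.
move=> Mpt; split=> [H|[e /gr_iso_sym ePM] r r2]; last first.
  apply: (point_ideal_iso ePM); apply/tangent_family_ideal => n.
  have [E1 E2] := point_mx2_vec n (vec e *m B i) r2.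
  by rewrite /Omega /omega; case: ifP.
have [x [p [px pn]]] := point_data_exists hpsi Mpt.
apply: (iso_tangent_family (i := i) px pn) => l li f [f1 fl] fi; have [Hh HH] := nondegP pn.
pose n := (l + i).+1.
have ln : (l < n)%N by rewrite /n; lia.
have iN : (i < n)%N by rewrite /n; lia.
pose G q := if q == l then f else Hh q.
have [|r [_ Er Hr]] := @product_elt _ _ _ _ hpsi c G n.
  by move=> q _; rewrite /G; case: eqP => [->|_] //; case: (HH q).
have /H : point_mx2 (orb i) (R_incl psi c r).
  exists [:: (f, \prod_(q < n | q != l :> nat) G q)].
    move=> T; rewrite inE => /eqP -> /=; split; first exact/(point_mx_homog_vec _ f1).
    rewrite (bigD1 (Ordinal iN)) /= 1?eq_sym // mulrC; apply: point_mx_mul.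
    have [[h1 hv] _] := HH i; rewrite /G eq_sym (negPf li).
    exact/(point_mx_homog_vec _ h1).
  rewrite big_cons big_nil addr0 /= -[LHS]/(rval r) Er (bigD1 (Ordinal ln)) //= {1}/G eqxx.
  by congr (_ * _); apply: eq_bigl => q; rewrite -val_eqE.
move/(point_ideal_basis r (pd_basis px)); rewrite (Hr _ _ _ px) => /scalar_eq0 [|E].
  rewrite (bigD1 (Ordinal ln)) //= {1}/G eqxx big1 ?mulr1 // => q.
  by rewrite -val_eqE /= /G => /negPf ->; case: (HH q).
by have := pd_neq0 px n; rewrite E eqxx.
Qed.

(** In degree n <= i the linear form is evaluation at c_i, constant in e; for n > i it is
    the derivative at c_i, which is linear in the coordinates of e. *)
Lemma tangent_family_algebraic i : algebraic_family (tangent_family i).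
Proof.
move=> n e0.
have ideal e a : a \in gcomp (ga_gr R) n ->
    point_ideal (tangent_family i e) a <-> omega phi c i (vec e *m B i) n (rval a) = 0.
  move=> an; rewrite tangent_family_ideal; split=> [/(_ n)|E m].
    by rewrite (Omega_homog _ _ _ _ an) eqxx.
  by rewrite (Omega_homog _ _ _ _ an) E if_same.
have [g [Hg _]] := tangent_module_data hpsi (nondeg_tangent_family i e0).
have [gn g1] := Hg n.
suff [D [L [HD HL]]] : exists (D : nat) (L : {linear R -> {mpoly k[t.+1]}}),
    (forall a, L a \is D.-homog) /\
    forall a e, a \in gcomp (ga_gr R) n ->
      (L a).@[vec e 0] = omega phi c i (vec e *m B i) n (rval a).
  exists D, L; split=> [a _||e _ a an]; first exact: HD.
    exists (g n) => //; move/(vanishes_vec _ (HD _)); rewrite HL // g1 => /eqP.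
    by rewrite oner_eq0.
  by rewrite ideal // (vanishes_vec _ (HD _)) HL.
have piP (s : k) (a b : R) : pihomog mdeg n (rval (s *: a + b)) =
    s *: pihomog mdeg n (rval a) + pihomog mdeg n (rval b) by exact: linearP.
have piE (a : R) : a \in gcomp (ga_gr R) n -> pihomog mdeg n (rval a) = rval a.
  by rewrite rval_homog; apply: pihomog_dE.
have [ni|iN] := leqP n i.
  pose L (a : R) : {mpoly k[t.+1]} := (pihomog mdeg n (rval a)).@[v_ i 0]%:MP.
  have Llin : linear L.
    by move=> s a b; rewrite /L piP mevalD mevalZ mpolyCD mpolyCM mul_mpolyC.
  pose F : {linear R -> {mpoly k[t.+1]}} :=
    HB.pack L (GRing.isLinear.Build k R {mpoly k[t.+1]} *:%R L Llin).
  exists 0%N, F; split=> [a|a e an] /=.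
    by rewrite /L -[_%:MP]mulr1 mul_mpolyC rpredZ // dhomog1.
  by rewrite /L mevalC piE // /omega ni.
pose L (a : R) : {mpoly k[t.+1]} :=
  \sum_j dir_deriv (pihomog mdeg n (rval a)) (row j (B i)) (v_ i) *: 'X_j.
have Llin : linear L.
  move=> s a b; rewrite /L scaler_sumr -big_split; apply: eq_bigr => j _ /=.
  by rewrite piP dir_derivP scalerDl scalerA.
pose F : {linear R -> {mpoly k[t.+1]}} :=
  HB.pack L (GRing.isLinear.Build k R {mpoly k[t.+1]} *:%R L Llin).
exists 1%N, F; split=> [a|a e an] /=.
  by apply: rpred_sum => j _; rewrite rpredZ ?form_X.
rewrite /L raddf_sum /= /omega leqNgt iN /= piE // mulmx_sum_row.
have dlin w w' : dir_deriv (rval a) (w + w') (v_ i) =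
    dir_deriv (rval a) w (v_ i) + dir_deriv (rval a) w' (v_ i).
  by have := dir_derivDr 1 (rval a) w w' (v_ i); rewrite scale1r mul1r.
have d0 : dir_deriv (rval a) 0 (v_ i) = 0 by apply: big1 => j _; rewrite mxE mul0r.
rewrite (big_morph (fun w => dir_deriv (rval a) w (v_ i)) dlin d0); apply: eq_bigr => j _.
rewrite mevalZ mevalXU mulrC -[_ *: _]addr0.
by rewrite dir_derivDr d0 addr0.
Qed.

End TangentFamily.

Theorem theorem6p6 (k : closedFieldType) (t : nat) (ht : (2 <= t)%N)
    (phi : proj_aut k t) (psi : graut k t.+1) (hpsi : induces psi phi)
    (c : ppoint k t) (hc : critical_density phi c) :
  let c_ := orbit_pt phi c in
  let R := R_alg psi c in
  let RP : ppoint k t -> grmod R := R_point psi c in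
  let off_orbit (d : ppoint k t) := forall i : nat, d <> c_ i in
  (forall d, off_orbit d ->
    is_point_module (RP d) /\
    forall r : R, point_ideal (RP d) r <-> point_mx d (R_incl psi c r)) /\
  (forall i : nat, is_shifted_point_module (gr_ge (RP (c_ i)) i.+1)) /\
  exists Pc : nat -> ppoint k t.-1 -> grmod R,
    (forall i : nat,
      [/\ algebraic_family (Pc i),
          forall e, is_point_module (Pc i e),
          forall e e', gr_iso (Pc i e) (Pc i e') -> e = e',
          forall e, gr_iso (gr_ge (Pc i e) i.+1) (gr_ge (RP (c_ i)) i.+1) /\
                    gr_iso (gr_le (Pc i e) i) (gr_le (RP (c_ i)) i) &
          forall M : grmod R, is_point_module M ->
            ((forall r : R, point_mx2 (c_ i) (R_incl psi c r) -> point_ideal M r) <->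
             exists e, gr_iso M (Pc i e))]) /\
    [/\ forall d d', off_orbit d -> off_orbit d' -> gr_iso (RP d) (RP d') -> d = d',
        forall d i e, off_orbit d -> ~ gr_iso (RP d) (Pc i e),
        forall i e i' e', gr_iso (Pc i e) (Pc i' e') -> i = i' /\ e = e' &
        forall M : grmod R, is_point_module M ->
          (exists2 d, off_orbit d & gr_iso M (RP d)) \/
          (exists i e, gr_iso M (Pc i e))].
Proof.
case: t ht phi psi hpsi c hc => [//|t] t2 phi psi hpsi c hc c_ R RP off_orbit.
have [orb_inj gen_pos] := critical_density_orbit hc.
have /choice [B HB] : forall i, exists B : 'M[k]_(t.+1, t.+2),
    (forall p, exists u s, p = u *m B + s *: v_ phi c i) /\
    (forall u s, u *m B = s *: v_ phi c i -> u = 0).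
  by move=> i; apply: complement_mx; apply: v_neq0.
have Bspan i := (HB i).1; have Bfree i := (HB i).2.
have nd d : off_orbit d -> nondeg phi c (fun=> vec d).
  by move=> dorb; apply: nondeg_off_orbit.
have RPdata d := R_point_data psi c d.
split; last split.
- move=> d dorb; split; last by move=> r; apply: R_point_ideal.
  by have [x [px _]] := RPdata d; apply: (point_module_data hpsi px); apply: nd.
- move=> i; have [x [px _]] := RPdata (c_ i).
  apply: (shifted_point_ge hpsi px) => n iN.
  by apply: nondeg_at_orbit => //; apply: contraTneq iN => ->; rewrite ltnn.
exists (tangent_family hpsi c B); split=> [i|]; split.
- exact: tangent_family_algebraic.
- exact: tangent_family_point_module.
- exact: tangent_family_inj.
- exact: tangent_family_truncations.
- exact: tangent_family_square.
- move=> d d' dorb dorb'; have [x [px _]] := RPdata d; have [y [py _]] := RPdata d'.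
  move=> /(point_data_iso hpsi px py) H; apply: contrapT => /(points_separated t2 gen_pos).
  by apply=> l _ _ f; apply: H.
- move=> d i e dorb; have [x [px _]] := RPdata d.
  have [y py] := tangent_family_data hpsi orb_inj Bfree i e.
  move=> /(point_data_iso hpsi px py) H; apply: (points_separated t2 gen_pos (dorb i)).
  move=> l _ il f Kf fi; apply: (H l f Kf); rewrite /tangent_pts; case: eqP => // li.
  by case: il; rewrite li.
- move=> i e i' e' iso; have E : i = i'.
    have [x px] := tangent_family_data hpsi orb_inj Bfree i e.
    have [y py] := tangent_family_data hpsi orb_inj Bfree i' e'.
    have H := point_data_iso hpsi px py iso; apply: contrapT => ii'.
    apply: (points_separated t2 gen_pos (d := orb phi c i) (d' := orb phi c i')).
      by move/orb_inj.
    move=> l il il' f Kf fi; have := H l f Kf; rewrite /tangent_pts.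
    case: eqP => [E|_]; first by case: il'; rewrite E.
    by case: eqP => [E|_]; [case: il; rewrite E | apply].
  by split=> //; move: iso; rewrite -E; apply: tangent_family_inj.
move=> M /(point_data_exists hpsi) [x [p [px pn]]].
have [d Hd] := common_point hpsi t2 orb_inj gen_pos px pn.
have [[i Ed]|dorb] := pselect (exists i : nat, d = c_ i).
  right; exists i; apply: (iso_tangent_family hpsi orb_inj Bspan Bfree px pn) => l li f Kf fi.
  by apply: Hd Kf _; rewrite ?Ed // => /orb_inj/esym/eqP; apply/negP.
left; have dorb' : off_orbit d by move=> i Ei; apply: dorb; exists i.
exists d => //; have [y [py _]] := RPdata d.
by apply: (iso_point_data hpsi px py pn) => l f; apply: Hd (dorb' l) f.
Qed.
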